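(* Let $n\to\infty$ along perfect squares, let $n_1=n_2=\sqrt n$, let $s=s_n\ge1$ be integers with $s=o(\sqrt n/\log n)$, and let $\mathcal{C}=\mathcal{C}_n$ be the class of $s$-submatrices of a $\sqrt n\times\sqrt n$ matrix. Let $m=m_n>0$, let $\mu=\mu_n>0$ be the signal magnitude, and let $\omega_n\to\infty$ be an arbitrary sequence. Consider the search/refinement procedure described in the context, with parameter $\delta=\delta_n$ suitably chosen and sufficiently small measurement precision $\Gamma$. (i) If $\mu\ge\omega_n\sqrt{\frac{n}{sm}}$, the procedure gives an estimator $\hat S$ such that $\lim_{n\to\infty}\max_{S\in\mathcal{C}}\mathbb{P}_S(\hat S\ne S)=0$, and it satisfies the precision budget $\mathbb{E}_S\big(\sum_j\Gamma_j\big)\le m$ for every $S\in\mathcal{C}$. (ii) If $\mu\ge\sqrt{\frac{2n}{sm}\left(\log s+\omega_n\right)^2}$, the procedure gives an estimator $\hat S$ such that $\lim_{n\to\infty}\max_{S\in\mathcal{C}}\mathbb{E}_S(|\hat S\triangle S|)=0$, and it satisfies the precision budget $\mathbb{E}_S\big(\sum_j\Gamma_j\big)\le m$ for every $S\in\mathcal{C}$.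
   Context: The $n=n_1n_2$ coordinates of the signal are identified with $\{1,\dots,n_1\}\times\{1,\dots,n_2\}$. An $s$-submatrix is a set $S_1\times S_2$ with $S_1\subseteq\{1,\dots,n_1\}$, $S_2\subseteq\{1,\dots,n_2\}$ and $|S_1|\cdot|S_2|=s$ (the class is assumed nonempty). Sensing model. For an unknown support set $S\in\mathcal{C}$ and $\mu>0$, the signal $\boldsymbol{x}\in\mathbb{R}^n$ has $x_i=\mu$ if $i\in S$ and $x_i=0$ otherwise. One collects measurements $Y_j=x_{A_j}+\Gamma_j^{-1/2}W_j$, $j=1,2,\dots$, where $A_j$ is the measured coordinate, $\Gamma_j>0$ is its precision, and the $W_j$ are i.i.d. $\mathcal{N}(0,1)$ with $W_j$ independent of $\{A_i,\Gamma_i\}_{i\le j}$. In adaptive sensing $A_j,\Gamma_j$ may depend on $\{Y_i,A_i,\Gamma_i\}_{i<j}$. Sums over $j$ run over the measurements made. The values $n,m,\mu$ and the class $\mathcal{C}$ are known; only $S$ is unknown. $\mathbb{P}_S,\mathbb{E}_S$ are probability and expectation when the support is $S$; $\triangle$ is symmetric difference. Procedure (with parameter $\delta\in(0,1)$). All measurements have the same precision $\Gamma_j=\Gamma$, taken sufficiently small. At step $t=1,2,\dots$ the procedure queries a coordinate $Q_t$ (no coordinate is queried twice) and computes a binary answer $\Psi_t$ (a surrogate for $\mathbf{1}\{Q_t\in S\}$) by a sequential likelihood ratio test with target type I and type II error probabilities $\alpha_t,\beta_t$: coordinate $Q_t$ is measured repeatedly, giving $y_1,y_2,\dots$, until the first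 $r$ at which $\bar z_r=\sum_{i=1}^r\log\frac{f_1(y_i)}{f_0(y_i)}$ leaves the interval $(l_t,u_t)$, where $f_0,f_1$ are the densities of $\mathcal{N}(0,\Gamma^{-1})$ and $\mathcal{N}(\mu,\Gamma^{-1})$, $l_t=\log\frac{\beta_t}{1-\alpha_t}$ and $u_t=\log\frac{1-\beta_t}{\alpha_t}$; then $\Psi_t=1$ if $\bar z_r\ge u_t$ and $\Psi_t=0$ if $\bar z_r\le l_t$. A coordinate is treated as non-zero when its answer is $1$. Queries: in the search phase coordinates are queried at random (uniformly among those not yet queried) until a non-zero coordinate is found, with at most $J=\frac ns\log\frac2\delta$ queries; in the refinement phase the coordinates in the row and in the column of the non-zero coordinate found are queried. Error probabilities: $\alpha_t=\delta/(8n)$ for all $t$, $\beta_t=\delta/4$ in the search phase, $\beta_t=\delta/(8s)$ in the refinement phase. The procedure stops at the first step $T$ at which there is at most one $S'\in\mathcal{C}$ with $\Psi_i=\mathbf{1}\{Q_i\in S'\}$ for all $i\le T$ (or when the search phase exhausts its $J$ queries without finding a non-zero coordinate). The estimator $\hat S$ is the unique $S'\in\mathcal{C}$ agreeing with all answers if there is exactly one, and $\hat S=\emptyset$ otherwise. *)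

(* Defs.v *)
From mathcomp Require Import all_boot all_order all_algebra perm.
From mathcomp Require Import all_classical all_reals all_analysis.

Set Implicit Arguments.
Unset Strict Implicit.
Unset Printing Implicit Defensive.

Import Order.TTheory GRing.Theory Num.Theory.
Import numFieldNormedType.Exports.
Local Open Scope classical_set_scope.
Local Open Scope ring_scope.

Definition coordinate (n1 n2 : nat) : finType := ('I_n1 * 'I_n2)%type.

Definition submatrices (n1 n2 s : nat) : {set {set coordinate n1 n2}} :=
  [set S : {set coordinate n1 n2} |
    [exists S1 : {set 'I_n1}, exists S2 : {set 'I_n2}, (S == finset.setX S1 S2)
       && (#|S1| * #|S2| == s)%N]]%SET.

Definition row_or_col (n1 n2 : nat) (c : coordinate n1 n2) :
    {set coordinate n1 n2} :=
  [set c' : coordinate n1 n2 | (c'.1 == c.1) || (c'.2 == c.2)]%SET.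

(* The sources of randomness.  The field [sm_prob S] is the probability when
   the support is [S].  The random permutation lists the coordinates in
   uniformly random order; reading that list from left to right amounts to
   drawing, each time, uniformly among the coordinates not yet drawn.  The last
   field says that, for every S, the permutation is uniform, the [sm_noise j]
   are i.i.d. N(0,1), and the noise is independent of the permutation. *)
Record sensing_model (R : realType) (n1 n2 : nat) := SensingModel {
  sm_display : measure_display;
  sm_space : measurableType sm_display;
  sm_prob : {set coordinate n1 n2} -> probability sm_space R;
  sm_perm : sm_space -> {perm coordinate n1 n2};
  sm_noise : nat -> {mfun sm_space >-> R};
  sm_perm_measurable : forall p, measurable (sm_perm @^-1` [set p]);
  sm_law : forall (S : {set coordinate n1 n2}) (p : {perm coordinate n1 n2})
      (k : nat) (B : nat -> set R), (forall j, measurable (B j)) ->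
    sm_prob S (sm_perm @^-1` [set p] `&`
               \bigcap_(j in `I_k) (sm_noise j @^-1` B j)) =
    (#|{perm coordinate n1 n2}|%:R^-1 *
     \prod_(j < k) fine (normal_prob (0 : R) 1 (B j)))%:E
}.

Section Procedure.
Context (R : realType) (n1 n2 s : nat) (mu delta Gamma : R).
(* [refine c]: order in which the row and column of [c] are gone through.
   [order]: the random list of coordinates used by the search phase. *)
Context (refine : coordinate n1 n2 -> seq (coordinate n1 n2)).
Context (order : seq (coordinate n1 n2)).

(* The completed queries, in chronological order, each with its answer. *)
Definition history := seq (coordinate n1 n2 * bool).

Definition queried (h : history) : seq (coordinate n1 n2) := map fst h.

Definition candidates (h : history) : {set {set coordinate n1 n2}} :=
  [set S' in submatrices n1 n2 s | all (fun qa => qa.2 == (qa.1 \in S')) h]%SET.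

(* The coordinate that ended the search phase; [None] during that phase. *)
Definition nonzero_found (h : history) : option (coordinate n1 n2) :=
  ohead (queried [seq qa <- h | qa.2]).

Definition search_budget : R := (n1 * n2)%:R / s%:R * ln (2 / delta).

(* In the second case one more search query would exceed the budget. *)
Definition stopped (h : history) : bool :=
  (h != [::]) && (#|candidates h| <= 1)%N
  || (nonzero_found h == None) && (search_budget < (size h).+1%:R).

(* Coordinate of the query following history [h]; [None] once stopped. *)
Definition next_query (h : history) : option (coordinate n1 n2) :=
  if stopped h then None
  else ohead [seq q <- (if nonzero_found h is Some c then refine c else order)
             | q \notin queried h].

Definition err1 : R := delta / (8 * (n1 * n2)%:R).

Definition err2 (h : history) : R :=
  if nonzero_found h is Some _ then delta / (8 * s%:R) else delta / 4.

Definition lower (h : history) : R := ln (err2 h / (1 - err1)).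

Definition upper (h : history) : R := ln ((1 - err2 h) / err1).

(* [normal_pdf] takes the standard deviation. *)
Definition log_likelihood_ratio (y : R) : R :=
  ln (normal_pdf mu (Num.sqrt Gamma^-1) y / normal_pdf 0 (Num.sqrt Gamma^-1) y).

Definition estimate (h : history) : {set coordinate n1 n2} :=
  odflt finset.set0 (unset1 (candidates h)).

Definition signal (S : {set coordinate n1 n2}) (c : coordinate n1 n2) : R :=
  if c \in S then mu else 0.

Context (S : {set coordinate n1 n2}) (W : nat -> R).

(* State after [j] measurements: the completed queries, and the running sum of
   log-likelihood ratios of the query in progress.  The measurement with index
   [j] (starting at 0) is made at [next_query (run j).1]; if this is [None], no
   measurement is made and the state no longer changes. *)
Fixpoint run (j : nat) : history * R :=
  if j isn't i.+1 then ([::], 0) else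
  let: (h, z) := run i in
  if next_query h is Some q then
    let y := signal S q + (Num.sqrt Gamma)^-1 * W i in
    let z' := z + log_likelihood_ratio y in
    if upper h <= z' then (rcons h (q, true), 0)
    else if z' <= lower h then (rcons h (q, false), 0)
    else (h, z')
  else (h, z).

Definition measured (j : nat) : option (coordinate n1 n2) :=
  next_query (run j).1.

Definition total_precision : \bar R :=
  (\sum_(0 <= j <oo) (if measured j is Some _ then Gamma else 0)%:E)%E.

(* If the measurements never end, the value is the empty set. *)
Definition estimator : {set coordinate n1 n2} :=
  if pselect (exists j, measured j == None) is left ex
  then estimate (run (ex_minn ex)).1 else finset.set0.

End Procedure.

Section OnModel.
Context (R : realType) (n1 n2 s : nat) (mu delta Gamma : R).
Context (refine : coordinate n1 n2 -> seq (coordinate n1 n2)).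
Context (M : sensing_model R n1 n2) (S : {set coordinate n1 n2}).

Definition search_order (w : sm_space M) : seq (coordinate n1 n2) :=
  [seq sm_perm w q | q <- enum (coordinate n1 n2)].

Definition Shat (w : sm_space M) : {set coordinate n1 n2} :=
  estimator s mu delta Gamma refine (search_order w) S
    (fun j => sm_noise M j w).

Definition precision_used (w : sm_space M) : \bar R :=
  total_precision s mu delta Gamma refine (search_order w) S
    (fun j => sm_noise M j w).

Definition error_probability : \bar R :=
  sm_prob M S [set w | Shat w <> S].

Definition expected_symdiff : \bar R :=
  'E_(sm_prob M S)[fun w => #|(Shat w :\: S) :|: (S :\: Shat w)|%SET%:R].

Definition expected_precision : \bar R :=
  (\int[sm_prob M S]_w precision_used w)%E.

End OnModel.

(* Main.v *)
Require Import Defs.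
From HB Require Import structures.
From mathcomp Require Import all_boot all_order all_algebra perm.
From mathcomp Require Import all_classical all_reals all_analysis.
From mathcomp Require Import measurable_realfun.
From mathcomp Require Import ring lra.

Set Implicit Arguments.
Unset Strict Implicit.
Unset Printing Implicit Defensive.

Import Order.TTheory GRing.Theory Num.Theory.
Import numFieldNormedType.Exports.
Local Open Scope classical_set_scope.
Local Open Scope ring_scope.

(* Along the run, the state (completed queries, running log-likelihood ratio) is a
   Markov chain driven by i.i.d. Gaussian noise, and both guarantees come from
   non-negative supermartingales.

   Precision: a test has log-likelihood increments of drift [-d] or [+d] with
   [d = Gamma mu^2 / 2], so by a Wald-type argument with O(1) overshoot it uses
   about (|log error| + 6) / d measurements. There are at most J tests of zero
   coordinates in the search, 2 N in the refinement, and at most s tests of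
   non-zero coordinates; since s log n = o(N) the search dominates.

   Error: the likelihood ratio is a martingale, hence a test errs with probability
   at most [exp (- upper)] or [exp lower]. Summing over the n zero coordinates, the
   s non-zero ones and the final search query, all answers are correct with
   probability at least 1 - delta; the search misses S with probability at most
   (1 - s/n)^J = O(delta); and the row and column of one coordinate of S determine
   S. For the second claim, the symmetric difference is at most 2 s. *)

(** * Markov chains driven by i.i.d. noise *)

(** Neither potential waits for a stopping time: each is a function of the current state bounding
    all that can still be spent, or go wrong, so a one-step inequality is iterated over a fixed
    number [k] of measurements. The run need not end for every noise sequence; but a run unfinished
    after [k] measurements has paid [k] times the drift, so the precision bound itself makes this
    event as rare as [delta] for large [k]. The total error is then [4 * delta]: [delta] for a wrong
    answer, [2 * delta] for a missed search, [delta] for an unfinished run. The second claim has no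
    slack in its constant [2], so the cost must be [(n / s) * (ln (1 / delta))^2] with leading
    coefficient one. Everything of lower order goes into the shift [10] of [(10 - ln delta)^2]; the
    choice of [delta] undoes this shift at the price of a factor [exp 10] in the error, which
    [omega] makes harmless. *)

Lemma measurable_fun_countable_cases d d' d'' (X : measurableType d)
    (Y : measurableType d') (T : measurableType d'') (enc : T -> nat)
    (g : X -> T) (f : X -> Y) :
  injective enc -> (forall t : T, measurable [set t]) ->
  measurable_fun setT g -> (forall t, measurable_fun (g @^-1` [set t]) f) ->
  measurable_fun setT f.
Proof.
move=> enc_inj mT mg mf.
have mgt t : measurable (g @^-1` [set t]) by rewrite -[X in measurable X]setTI; exact: mg.
pose F n := [set x | enc (g x) = n].
have FE n : F n = set0 \/ exists t, F n = g @^-1` [set t].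
  have [[x Fx]|nF] := pselect (exists x, F n x); last first.
    by left; apply/seteqP; split => // x Fx; apply: nF; exists x.
  right; exists (g x); apply/seteqP; split => y /=; rewrite /F /= => gy.
    by apply: enc_inj; rewrite gy Fx.
  by rewrite gy Fx.
have -> : [set: X] = \bigcup_n F n by apply/seteqP; split => // x _; exists (enc (g x)).
apply/measurable_fun_bigcup => n; first by have [->|[t ->]] := FE n.
by have [->|[t ->]] := FE n; [exact: measurable_fun_set0|exact: mf].
Qed.

Section markov_chain.
Context d dX (Omega : measurableType d) (X : measurableType dX) (R : realType).
Context (P : probability Omega R) (gamma : probability R R).
Context (W : nat -> {mfun Omega >-> R}) (f : X * R -> X) (Z : nat -> Omega -> X).
Hypothesis mf : measurable_fun setT f.
Hypothesis mZ0 : measurable_fun setT (Z 0).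
Hypothesis ZS : forall j w, Z j.+1 w = f (Z j w, W j w).
Hypothesis indep0 : forall A k (B : nat -> set R), measurable A ->
  (forall i, measurable (B i)) ->
  P (Z 0 @^-1` A `&` \bigcap_(i in `I_k) (W i @^-1` B i)) =
  (P (Z 0 @^-1` A) * (\prod_(i < k) fine (gamma (B i)))%:E)%E.

Lemma measurable_chain j : measurable_fun setT (Z j).
Proof.
elim: j => [//|j ih].
have -> : Z j.+1 = f \o (fun w => (Z j w, W j w)) by apply/funext => w /=; rewrite ZS.
by apply: measurableT_comp => //; exact: measurable_fun_pair.
Qed.

Let Zm j : {mfun Omega >-> X} :=
  HB.pack (Z j) (isMeasurableFun.Build _ _ _ _ (Z j) (measurable_chain j)).

Let step j w := (Z j w, W j w).

Let measurable_step j : measurable_fun setT (step j).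
Proof. by apply: measurable_fun_pair => //; exact: measurable_chain. Qed.

Let stepm j : {mfun Omega >-> (X * R)%type} :=
  HB.pack (step j) (isMeasurableFun.Build _ _ _ _ (step j) (measurable_step j)).

Let future k j (B : nat -> set R) :=
  \bigcap_(i in `I_k) (W (j + i)%N @^-1` B i).

Let measurable_future k j B : (forall i, measurable (B i)) -> measurable (future k j B).
Proof.
move=> mB; apply: bigcap_measurableType => i _.
by rewrite -[X in measurable X]setTI; exact: measurable_funPT.
Qed.

Let future0 j B : future 0 j B = setT.
Proof. by apply/seteqP; split => // w _ i. Qed.

Let measurable_preimageT d1 d2 (T1 : measurableType d1) (T2 : measurableType d2)
  (g : T1 -> T2) A : measurable_fun setT g -> measurable A -> measurable (g @^-1` A).
Proof. by move=> mg mA; rewrite -[X in measurable X]setTI; exact: mg. Qed.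

(** As functions of [C] both sides are measures. [W j] is the first coordinate of the future of
    [Z j], so the hypothesis at [j] gives equality on rectangles, and uniqueness of the product
    measure extends it to events mixing state and noise. *)
Let chain_indep_step j :
  (forall A k B, measurable A -> (forall i, measurable (B i)) ->
    P (Z j @^-1` A `&` future k j B) =
    (P (Z j @^-1` A) * (\prod_(i < k) fine (gamma (B i)))%:E)%E) ->
  forall C k B, measurable C -> (forall i, measurable (B i)) ->
  P (step j @^-1` C `&` future k j.+1 B) =
  ((distribution P (Zm j) \x gamma) C * (\prod_(i < k) fine (gamma (B i)))%:E)%E.
Proof.
move=> ih C k B mC mB.
set p := \prod_(i < k) _.
have p0 : 0 <= p by apply: prodr_ge0 => i _; rewrite fine_ge0.
have mF := measurable_future k j.+1 mB.
have rect A D : measurable A -> measurable D ->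
    P (step j @^-1` (A `*` D) `&` future k j.+1 B) =
    (P (Z j @^-1` A) * gamma D * p%:E)%E.
  move=> mA mD; pose B' i := if i is i'.+1 then B i' else D.
  have mB' i : measurable (B' i) by case: i.
  have -> : step j @^-1` (A `*` D) `&` future k j.+1 B =
      Z j @^-1` A `&` future k.+1 j B'.
    apply/seteqP; split => w /=.
      move=> [[/= ZA WD] FB]; split => // -[_|i] /=; first by rewrite addn0.
      by rewrite ltnS => ik; rewrite addnS -addSn; exact: FB.
    move=> [ZA FB']; split; first split => //=.
      by have := FB' 0%N isT; rewrite /= addn0.
    by move=> i /= ik; have := FB' i.+1 ik; rewrite /= addnS -addSn.
  rewrite ih// big_ord_recl /= EFinM -muleA; congr (_ * (_ * _))%E.
  by rewrite fineK// fin_num_measure.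
(* The comparison with the product measure divides by [p]. When [p] is zero, the event lies in the
   full rectangle, which is already null. *)
have [p_eq0|p_neq0] := eqVneq p 0.
  rewrite p_eq0 mule0; apply/eqP; rewrite eq_le measure_ge0 andbT.
  have := rect setT setT measurableT measurableT.
  rewrite p_eq0 mule0 => <-; apply: le_measure; rewrite ?inE.
  - by apply: measurableI => //; exact: measurable_preimageT.
  - by apply: measurableI => //; apply: measurable_preimageT => //; exact: measurableX.
  - by move=> w [_ ?]; split.
have pV0 : 0 <= p^-1 by rewrite invr_ge0.
have [m m_E] : exists m : {measure set (X * R) -> \bar R},
    forall D, m D = P (step j @^-1` D `&` future k j.+1 B).
  unshelve eexists (pushforward (mrestr P mF) (stepm j)); first exact: measurable_step.
  by [].
pose m' : {measure set (X * R) -> \bar R} := mscale (NngNum pV0) m.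
have m'E D : m' D = (p^-1%:E * P (step j @^-1` D `&` future k j.+1 B))%E.
  by rewrite -m_E.
have -> : (distribution P (Zm j) \x gamma)%E C = m' C.
  apply: product_measure_unique => // A D mA mD.
  have -> : m' (A `*` D) = (p^-1%:E * P (step j @^-1` (A `*` D) `&` future k j.+1 B))%E.
    exact: m'E.
  by rewrite rect// muleCA -EFinM mulVf// mule1.
have -> : m' C = (p^-1%:E * P (step j @^-1` C `&` future k j.+1 B))%E by exact: m'E.
by rewrite muleAC -EFinM mulVf// mul1e.
Qed.

Let chain_indep j A k B : measurable A -> (forall i, measurable (B i)) ->
    P (Z j @^-1` A `&` future k j B) =
    (P (Z j @^-1` A) * (\prod_(i < k) fine (gamma (B i)))%:E)%E.
Proof.
elim: j A k B => [|j ih] A k B mA mB; first exact: indep0.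
have ZSE : Z j.+1 @^-1` A = step j @^-1` (f @^-1` A).
  by apply/seteqP; split => w; rewrite /preimage /= ZS.
have mfA := measurable_preimageT mf mA.
rewrite ZSE (chain_indep_step ih)//; congr (_ * _)%E.
(* With an empty future the same identity computes the product measure of the preimage of [A]. *)
have := chain_indep_step ih 0 mfA mB.
rewrite big_ord0 mule1 => <-; congr (P _).
by rewrite future0 setIT.
Qed.

(** The pair of current state and noise has a product law, so Tonelli applies. Only non-negativity
    is asked of [Phi], which may take the value [+oo]. *)
Lemma integral_chainS j (Phi : X -> \bar R) : measurable_fun [set: X] Phi ->
  (forall x, 0 <= Phi x)%E ->
  (\int[P]_w Phi (Z j.+1 w) = \int[P]_w \int[gamma]_y Phi (f (Z j w, y)))%E.
Proof.
move=> mPhi Phi0.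
have mPf : measurable_fun setT (Phi \o f) by exact: measurableT_comp.
transitivity (\int[distribution P (stepm j)]_z (Phi \o f) z)%E.
  rewrite ge0_integral_distribution// => [|z]; last exact: Phi0.
  by apply: eq_integral => w _ /=; rewrite ZS.
rewrite (eq_measure_integral (distribution P (Zm j) \x gamma)%E); last first.
  move=> A mA _; have := chain_indep_step (@chain_indep j) 0 mA (fun i => measurableT).
  rewrite big_ord0 mule1 /= => <-; congr (P _).
  by rewrite future0 setIT.
rewrite fubini_tonelli1//; last by move=> z; exact: Phi0.
rewrite ge0_integral_distribution//; last first.
  by move=> y; apply: integral_ge0 => z _; exact: Phi0.
by apply: measurable_fun_fubini_tonelli_F => // z; exact: Phi0.
Qed.

(** The drift condition telescopes, as in Dynkin's formula. It is stated without subtraction, so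
    infinite values of [Phi] do no harm. *)
Lemma integral_chain_le (Phi cost : X -> \bar R) k :
  measurable_fun [set: X] Phi -> measurable_fun [set: X] cost ->
  (forall x, 0 <= Phi x)%E -> (forall x, 0 <= cost x)%E ->
  (forall x, cost x + \int[gamma]_y Phi (f (x, y)) <= Phi x)%E ->
  (\sum_(j < k) \int[P]_w cost (Z j w) + \int[P]_w Phi (Z k w)
    <= \int[P]_w Phi (Z 0 w))%E.
Proof.
move=> mPhi mcost Phi0 cost0 drift; elim: k => [|k ih].
  by rewrite big_ord0 add0e.
apply: le_trans ih; rewrite big_ord_recr /= -addeA leeD2l// integral_chainS//.
have mK : measurable_fun setT (fun x => \int[gamma]_y Phi (f (x, y)))%E.
  apply: (@measurable_fun_fubini_tonelli_F _ _ X _ _ gamma (Phi \o f)) => //.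
    exact: measurableT_comp.
  by move=> z; exact: Phi0.
have mZk := measurable_chain k.
rewrite -ge0_integralD//=.
- apply: ge0_le_integral => //.
  + by move=> w _; apply: adde_ge0 => //; apply: integral_ge0 => y _; exact: Phi0.
  + by apply: emeasurable_funD; [exact: (measurableT_comp mcost)|exact: (measurableT_comp mK)].
  + exact: (measurableT_comp mPhi).
- exact: (measurableT_comp mcost).
- by move=> w _; apply: integral_ge0 => y _; exact: Phi0.
- exact: (measurableT_comp mK).
Qed.

End markov_chain.

(** * Gaussian integrals *)

Section density.
Local Open Scope ereal_scope.
Context d (T : measurableType d) (R : realType).
Context (mu nu : {measure set T -> \bar R}) (p : T -> R).
Hypothesis mp : measurable_fun setT p.
Hypothesis p0 : forall x, (0 <= p x)%R.
Hypothesis nuE : forall A, measurable A -> nu A = \int[mu]_(x in A) (p x)%:E.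

Let measurable_p : measurable_fun setT (EFin \o p).
Proof. exact/measurable_EFinP. Qed.

Import HBNNSimple.

Let integral_density_indic A : measurable A ->
  \int[nu]_x (\1_A x)%:E = \int[mu]_x ((\1_A x)%:E * (p x)%:E).
Proof.
move=> mA; rewrite integral_indic// setIT nuE// integral_mkcond.
by apply: eq_integral => x _; rewrite patchE indicE; case: ifP => _; rewrite ?mul1e ?mul0e.
Qed.

Let integral_density_nnsfun (f : {nnsfun T >-> R}) :
  \int[nu]_x (f x)%:E = \int[mu]_x ((f x)%:E * (p x)%:E).
Proof.
under eq_integral do rewrite fimfunE -fsumEFin//.
rewrite ge0_integral_fsum//; last 2 first.
  - by move=> r; exact/measurable_EFinP/measurableT_comp.
  - by move=> n x _; rewrite EFinM nnfun_muleindic_ge0.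
under [RHS]eq_integral.
  move=> x xD; rewrite fimfunE -fsumEFin// ge0_mule_fsuml; last first.
    by move=> r; rewrite EFinM nnfun_muleindic_ge0.
  over.
rewrite [RHS]ge0_integral_fsum//; last 2 first.
  - move=> r; apply: emeasurable_funM => //; apply/measurable_EFinP.
    exact: measurableT_comp.
  - move=> n x _; rewrite mule_ge0 ?lee_fin//.
    by rewrite -lee_fin EFinM nnfun_muleindic_ge0.
apply: eq_fsbigr => r /[!inE] -[x _ fxr].
have r0 : (0 <= r)%R by rewrite -fxr.
rewrite integralZl_indic_nnsfun// integral_density_indic// -ge0_integralZl//.
- by apply: eq_integral => y _; rewrite EFinM muleA.
- by apply: emeasurable_funM => //; exact/measurable_EFinP.
- by move=> y _; rewrite mule_ge0 ?lee_fin.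
Qed.

(** The usual extension from indicators through simple functions to monotone limits; it reduces
    Gaussian integrals to Lebesgue integrals. *)
Lemma ge0_integral_density (f : T -> \bar R) : measurable_fun [set: T] f ->
  (forall x, 0 <= f x) -> \int[nu]_x f x = \int[mu]_x (f x * (p x)%:E).
Proof.
move=> mf f0; pose f_ := nnsfun_approx measurableT mf.
transitivity (limn (fun n => \int[nu]_x (f_ n x)%:E)).
  rewrite -monotone_convergence//.
  - by apply: eq_integral => y _; apply/esym/cvg_lim => //; exact: cvg_nnsfun_approx.
  - by move=> n; exact/measurable_EFinP.
  - by move=> n y _; rewrite lee_fin.
  - by move=> y _ m n mn; rewrite lee_fin; exact/lefP/nd_nnsfun_approx.
rewrite (_ : (fun n => _) = (fun n => \int[mu]_x ((f_ n x)%:E * (p x)%:E))); last first.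
  by apply/funext => n; exact: integral_density_nnsfun.
rewrite -monotone_convergence//.
- apply: eq_integral => y _; apply/cvg_lim => //.
  by apply: cvgeZr => //; exact: cvg_nnsfun_approx.
- by move=> n; apply: emeasurable_funM => //; exact/measurable_EFinP.
- by move=> n y _; rewrite mule_ge0 ?lee_fin.
- move=> y _ m n mn; apply: lee_wpmul2r; rewrite lee_fin//.
  exact/lefP/nd_nnsfun_approx.
Qed.

End density.

Section gaussian.
Context (R : realType).
Local Notation gauss := (normal_prob (0 : R) 1).

(** Completing the square turns the tilted density into that of N(t, 1), of mass one. *)
Lemma integral_normal_expR (t : R) :
  (\int[gauss]_y (expR (t * y))%:E = (expR (t ^+ 2 / 2))%:E)%E.
Proof.
rewrite (@ge0_integral_density _ _ _ lebesgue_measure _ (normal_pdf 0 1))//.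
- transitivity (\int[lebesgue_measure]_y
     ((expR (t ^+ 2 / 2))%:E * (normal_pdf t 1 y)%:E))%E.
    apply: eq_integral => y _; rewrite -!EFinM; congr EFin.
    rewrite !normal_pdfE ?oner_neq0// mulrCA [RHS]mulrCA; congr (_ * _).
    rewrite /normal_fun -!expRD; congr expR; by field.
  rewrite integralZl//; last exact: integrable_normal_pdf.
  by rewrite integral_normal_pdf mule1.
- exact: measurable_normal_pdf.
- exact: normal_pdf_ge0.
- by apply/measurable_EFinP; apply: measurableT_comp => //; exact: measurable_funM.
Qed.

Lemma integrable_normal_expR (t : R) :
  gauss.-integrable setT (fun y => (expR (t * y))%:E).
Proof.
apply/integrableP; split.
  by apply/measurable_EFinP; apply: measurableT_comp => //; exact: measurable_funM.
under eq_integral do rewrite gee0_abs ?lee_fin ?expR_ge0//.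
by rewrite integral_normal_expR ltry.
Qed.

Lemma integrable_normal_id : gauss.-integrable setT (fun y => y%:E).
Proof.
have := integrableD measurableT (integrable_normal_expR 1) (integrable_normal_expR (-1)).
apply: le_integrable => //=; first exact/measurable_EFinP.
move=> y _; rewrite lee_fin mul1r mulN1r.
rewrite [leRHS]ger0_norm ?addr_ge0 ?expR_ge0//.
have [y0|y0] := leP 0 y.
- rewrite ger0_norm//; have := expR_ge1Dx y; have := expR_ge0 (- y); lra.
- rewrite ltr0_norm//; have := expR_ge1Dx (- y); have := expR_ge0 y; lra.
Qed.

(** The mean [r] is read off the moment generating function: [1 + t * r <= exp (t^2 / 2)] for all
    real [t], so letting [t] be small of either sign forces [r = 0]. *)
Lemma integral_normal_id : (\int[gauss]_y y%:E = 0)%E.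
Proof.
have iid := integrable_normal_id.
have Ifin : (\int[gauss]_y y%:E)%E \is a fin_num by exact: integrable_fin_num.
set I := (\int[gauss]_y y%:E)%E in Ifin *; rewrite -(fineK Ifin); set r := fine I.
have key t : 1 + t * r <= expR (t ^+ 2 / 2).
  rewrite -lee_fin -integral_normal_expR EFinD EFinM (fineK Ifin).
  have -> : (1%:E + t%:E * I = \int[gauss]_y (1 + t * y)%:E)%E.
    under eq_integral do rewrite EFinD EFinM.
    rewrite integralD//=; last 2 first.
    - exact: finite_measure_integrable_cst.
    - exact: integrableZl.
    congr (_ + _)%E; last by rewrite integralZl.
    rewrite integral_cst// mul1e; apply/esym.
    exact: (@probability_setT _ _ _ gauss).
  apply: le_integral => //=.
  - under eq_fun do rewrite EFinD EFinM.
    apply: integrableD => //; first exact: finite_measure_integrable_cst.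
    exact: integrableZl.
  - exact: integrable_normal_expR.
  - by move=> y _; rewrite lee_fin expR_ge1Dx.
(* With [u = t^2 / 2 <= 1 / 2], one has [exp u <= 1 / (1 - u) <= 1 + 2 * u]. Below, [t = r / 2],
   truncated to [[-1, 1]], is the contradicting choice. *)
have key2 t : `|t| <= 1 -> t * r <= t ^+ 2.
  move=> t1; have := key t.
  have t2 : t ^+ 2 <= 1 by rewrite -real_normK ?num_real// expr_le1.
  have E0 : expR (t ^+ 2 / 2) * expR (- (t ^+ 2 / 2)) = 1 by rewrite expRxMexpNx_1.
  have E1 := expR_ge1Dx (- (t ^+ 2 / 2)); have E2 := expR_gt0 (t ^+ 2 / 2).
  have t0 : 0 <= t ^+ 2 by exact: sqr_ge0.
  nra.
congr EFin; apply/eqP; rewrite eq_le; apply/andP; split; rewrite leNgt; apply/negP => r0.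
- have := key2 (Num.min 1 (r / 2)).
  have [r2|r2] := leP 1 (r / 2); first by rewrite normr1 => /(_ (lexx _)); lra.
  rewrite ger0_norm; last by lra.
  by move=> /(_ (ltW r2)); nra.
- have := key2 (Num.max (- 1) (r / 2)).
  have [r2|r2] := leP (- 1) (r / 2); last first.
    by rewrite normrN1 => /(_ (lexx _)); lra.
  rewrite ltr0_norm; last by lra.
  by move=> /(_ ltac:(lra)); nra.
Qed.

End gaussian.

(** * Potentials of a Gaussian walk with drift *)

Section gaussian_potential.
Context (R : realType).
Local Notation gauss := (normal_prob (0 : R) 1).

Lemma integral_normal_combination (a b c1 t1 c2 t2 : R) :
  (\int[gauss]_y (a + b * y + c1 * expR (t1 * y) + c2 * expR (t2 * y))%:E =
   (a + c1 * expR (t1 ^+ 2 / 2) + c2 * expR (t2 ^+ 2 / 2))%:E)%E.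
Proof.
have ia : gauss.-integrable setT (fun=> a%:E) by exact: finite_measure_integrable_cst.
have ib : gauss.-integrable setT (fun y => b%:E * y%:E)%E.
  exact: (integrableZl _ _ (@integrable_normal_id R)).
have iE c t : gauss.-integrable setT (fun y => c%:E * (expR (t * y))%:E)%E.
  exact: (integrableZl _ _ (@integrable_normal_expR R t)).
transitivity (\int[gauss]_y ((a%:E + b%:E * y%:E) + c1%:E * (expR (t1 * y))%:E +
    c2%:E * (expR (t2 * y))%:E))%E.
  by apply: eq_integral => y _; rewrite -!EFinM -!EFinD.
have iab := integrableD measurableT ia ib.
have iab1 := integrableD measurableT iab (iE c1 t1).
rewrite (integralD measurableT iab1 (iE c2 t2)) (integralD measurableT iab (iE c1 t1)).
rewrite (integralD measurableT ia ib).
rewrite !(integralZl measurableT (integrable_normal_expR _)).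
rewrite (integralZl measurableT (@integrable_normal_id R)) !integral_normal_expR.
rewrite integral_normal_id mule0 adde0 !EFinD !EFinM; congr (_ + _ + _)%E.
have -> : (\int[gauss]_y a%:E = a%:E * gauss setT)%E by exact: integral_cst.
by rewrite (@probability_setT _ _ _ gauss) mule1.
Qed.

(* [y] is the distance of a Gaussian walk with drift [-d] and variance [2 d] to
   its exit level. For [y >= 0] and small [d] the potential loses at least [d] per
   step in expectation; the exponentials keep it non-negative after an overshoot of
   any size, and are eigenfunctions of the walk. *)
Definition walk_potential (y : R) := y + 6 - 4 * expR (- y) + expR (- (2 * y)).

Let potential_square (y : R) :
  walk_potential y = y + 6 + (expR (- y) ^+ 2 - 4 * expR (- y)).
Proof.
rewrite /walk_potential [expR (- (2 * y))](_ : _ = expR (- y) ^+ 2); first ring.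
by rewrite expr2 -expRD; congr expR; ring.
Qed.

(** With [t = exp (- y)], the bound [y >= 1 - t] leaves [t^2 - 5 * t + 7 = (t - 5/2)^2 + 3/4]; the
    constant [6] makes this positive. *)
Lemma walk_potential_ge0 y : 0 <= walk_potential y.
Proof.
rewrite potential_square; have := expR_ge1Dx (- y) => h.
have ty : - y <= expR (- y) - 1 by lra.
by have := sqr_ge0 (expR (- y) - 5 / 2); nra.
Qed.

Lemma walk_potential_le y : 0 <= y -> walk_potential y <= y + 6.
Proof.
move=> y0; rewrite potential_square.
have t1 : expR (- y) <= 1 by rewrite -expR0 ler_expR; lra.
by have := expR_gt0 (- y); nra.
Qed.

Lemma measurable_walk_potential : measurable_fun [set: R] walk_potential.
Proof.
have mE (c : R) : measurable_fun [set: R] (fun y => expR (- (c * y))).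
  by apply: measurableT_comp => //; apply: measurableT_comp => //; exact: measurable_funM.
have mE1 : measurable_fun [set: R] (fun y : R => expR (- y)) by exact: measurableT_comp.
have mE4 : measurable_fun [set: R] (fun y : R => 4 * expR (- y)) by exact: measurable_funM.
have mD : measurable_fun [set: R] (fun y : R => y + 6) by exact: measurable_funD.
exact: (measurable_funD (measurable_funB mD mE4) (mE 2)).
Qed.

(** With [t = exp (- y)] and [q = exp (2 * d)], one step multiplies [t] by [q] and [t^2] by [q^3] in
    expectation. The claim becomes [t * (q^2 + q + 1) <= 4], true since [t <= 1] (from [y >= 0]) and
    [q <= 6/5], which is what [d <= 1/12] provides. *)
Lemma integral_walk_potential (sg d y b : R) : sg ^+ 2 = 2 * d -> 0 <= d <= 12^-1 ->
  0 <= y ->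
  (\int[gauss]_w (walk_potential (y + (sg * w - d)) + b)%:E
    <= (walk_potential y - d + b)%:E)%E.
Proof.
move=> sgE /andP[d0 d1] y0.
rewrite (_ : (fun w => _) = (fun w => (((y - d + 6 + b) + sg * w +
    (- 4 * (expR (- y) * expR d)) * expR (- sg * w) +
    (expR (- (2 * y)) * expR (2 * d)) * expR (- 2 * sg * w))%:E))); last first.
  apply/funext => w; congr EFin; rewrite /walk_potential -!mulrA -!expRD.
  rewrite [- (y + _)](_ : _ = - y + (d + - sg * w)); last by ring.
  rewrite [- (2 * (y + _))](_ : _ = - (2 * y) + (2 * d + - 2 * (sg * w))); last by ring.
  by ring.
rewrite integral_normal_combination lee_fin /walk_potential.
have -> : (- sg) ^+ 2 / 2 = d by rewrite sqrrN sgE; field.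
have -> : (- 2 * sg) ^+ 2 / 2 = 4 * d by rewrite exprMn sgE; field.
have e1 : expR (- (2 * y)) = expR (- y) ^+ 2 by rewrite expr2 -expRD; congr expR; ring.
have e2 : expR d * expR d = expR (2 * d) by rewrite -expRD; congr expR; ring.
have e4 : expR (4 * d) = expR (2 * d) ^+ 2 by rewrite expr2 -expRD; congr expR; ring.
have q1 : 1 <= expR (2 * d) by rewrite -[leLHS]expR0 ler_expR; lra.
have q2 : expR (2 * d) <= 6 / 5.
  have E1 := expR_ge1Dx (- (2 * d)); have := expRxMexpNx_1 (2 * d); nra.
have t0 := expR_gt0 (- y).
have t1 : expR (- y) <= 1 by rewrite -expR0 ler_expR; lra.
rewrite -!mulrA e2 e1 e4; move: t0 t1 q1 q2; set t := expR (- y); set q := expR (2 * d).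
move=> t0 t1 q1 q2.
have : t * (q * q ^+ 2 - 1) <= 4 * (q - 1).
  have -> : q * q ^+ 2 - 1 = (q - 1) * (q ^+ 2 + q + 1) by ring.
  have q4 : q ^+ 2 + q + 1 <= 4 by nra.
  have q0 : 0 <= q ^+ 2 + q + 1 by nra.
  apply: (@le_trans _ _ ((q - 1) * (q ^+ 2 + q + 1))).
    by apply: ler_piMl => //; apply: mulr_ge0 => //; lra.
  by rewrite [leRHS]mulrC; apply: ler_wpM2l => //; lra.
by move=> h; have : t * (t * (q * q ^+ 2 - 1)) <= t * (4 * (q - 1)); [rewrite ler_pM2l|nra].
Qed.

(** The drift [- d] is minus half the variance [2 * d], which exactly cancels the growth of the
    exponential. *)
Lemma integral_exp_martingale (sg d y b : R) : sg ^+ 2 = 2 * d ->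
  (\int[gauss]_w (expR (y + (sg * w - d)) + b)%:E = (expR y + b)%:E)%E.
Proof.
move=> sgE.
rewrite (_ : (fun w => _) = (fun w => ((b + 0 * w + (expR y * expR (- d)) *
    expR (sg * w) + 0 * expR (0 * w))%:E))); last first.
  apply/funext => w; congr EFin; rewrite !mul0r !addr0 addrC -!expRD.
  by congr (_ + expR _); ring.
rewrite integral_normal_combination mul0r addr0 addrC -!expRD.
by congr (expR _ + _)%:E; rewrite sgE; field.
Qed.

End gaussian_potential.

(** * Error levels and costs of the tests *)

Section procedure_steps.
Context (R : realType) (n1 n2 s : nat) (delta : R).
Context (refine : coordinate n1 n2 -> seq (coordinate n1 n2)).
Context (S : {set coordinate n1 n2}).
Hypothesis refineP : forall c, perm_eq (refine c) (enum (row_or_col c)).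
Hypothesis n_gt0 : (0 < n1 * n2)%N.
Hypothesis s_gt0 : (0 < s)%N.
Hypothesis delta01 : 0 < delta < 1.

Implicit Types (h : history n1 n2) (q : coordinate n1 n2) (order : seq (coordinate n1 n2)).

Local Notation next := (next_query s delta refine).
Local Notation low := (lower s delta).
Local Notation up := (upper s delta).

Lemma next_queryP order h q : next order h = Some q ->
  [/\ ~~ stopped s delta h, q \notin queried h &
      q \in (if nonzero_found h is Some c then refine c else order)].
Proof.
rewrite /next_query; case: ifP => // _ qE.
have : q \in [seq q <- (if nonzero_found h is Some c then refine c else order)
             | q \notin queried h].
  by move: qE; case: [seq _ <- _ | _] => //= a l [->]; exact: mem_head.
by rewrite mem_filter => /andP[-> ->].
Qed.

Lemma nonzero_found_rcons h q b : nonzero_found (rcons h (q, b)) =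
  if nonzero_found h is Some c then Some c else if b then Some q else None.
Proof.
rewrite /nonzero_found /queried filter_rcons; case: b => /=; last by case: ohead.
by rewrite map_rcons; case: [seq _ <- _ | _].
Qed.

Lemma queried_rcons h q b : queried (rcons h (q, b)) = rcons (queried h) q.
Proof. by rewrite /queried map_rcons. Qed.

Definition unqueried (L : seq (coordinate n1 n2)) h : nat :=
  count (fun q => q \notin queried h) L.

Lemma unqueried_rcons_le L h q b : (unqueried L (rcons h (q, b)) <= unqueried L h)%N.
Proof.
apply: sub_count => c; rewrite queried_rcons mem_rcons inE negb_or.
by case/andP.
Qed.

Lemma unqueried_rcons_lt L h q b : q \in L -> q \notin queried h ->
  (unqueried L (rcons h (q, b)) < unqueried L h)%N.
Proof.
move=> qL qh; elim: L qL => //= c L ih; rewrite inE => /orP[/eqP <-|/ih cL].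
  rewrite qh queried_rcons mem_rcons mem_head /= add0n add1n ltnS.
  exact: unqueried_rcons_le.
rewrite -addnS; apply: leq_add => //.
rewrite queried_rcons mem_rcons inE negb_or.
by case: (c \in queried h); rewrite /= ?andbF ?andbT// leq_b1.
Qed.

Lemma unqueried_nil L : unqueried L [::] = size L.
Proof. by rewrite /unqueried -[RHS]count_predT; apply: eq_count => c. Qed.

Lemma unqueried_size L h : (unqueried L h <= size L)%N.
Proof. exact: count_size. Qed.

Local Notation n := ((n1 * n2)%:R : R).

Let n_ge1 : 1 <= n. Proof. by rewrite ler1n. Qed.
Let s_ge1 : 1 <= (s%:R : R). Proof. by rewrite ler1n. Qed.
Let delta_gt0 : 0 < delta. Proof. by case/andP: delta01. Qed.
Let delta_lt1 : delta < 1. Proof. by case/andP: delta01. Qed.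

Local Ltac numeric_facts := move: n_ge1 s_ge1 delta_gt0 delta_lt1 => ? ? ? ?.

Lemma err1_bounds : 0 < err1 n1 n2 delta <= 8^-1.
Proof.
numeric_facts; rewrite /err1 divr_gt0//=; last by rewrite mulr_gt0//; lra.
by rewrite ler_pdivrMr; [nra|rewrite mulr_gt0//; lra].
Qed.

Lemma err2_bounds h : 0 < err2 s delta h <= 4^-1.
Proof.
numeric_facts; rewrite /err2; case: nonzero_found => [c|]; last by apply/andP; split; lra.
rewrite divr_gt0//=; last by rewrite mulr_gt0//; lra.
by rewrite ler_pdivrMr; [nra|rewrite mulr_gt0//; lra].
Qed.

Lemma expR_lower h : expR (low h) = err2 s delta h / (1 - err1 n1 n2 delta).
Proof.
have /andP[e1 e1'] := err1_bounds; have /andP[e2 _] := err2_bounds h.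
by rewrite /lower lnK// posrE; apply: divr_gt0 => //; lra.
Qed.

Lemma expRN_upper h : expR (- up h) = err1 n1 n2 delta / (1 - err2 s delta h).
Proof.
have /andP[e1 e1'] := err1_bounds; have /andP[e2 e2'] := err2_bounds h.
rewrite expRN /upper lnK; first by rewrite invf_div.
by rewrite posrE; apply: divr_gt0 => //; lra.
Qed.

Lemma lower_lt0 h : low h < 0.
Proof.
have /andP[e1 e1'] := err1_bounds; have /andP[e2 e2'] := err2_bounds h.
by rewrite -ltr_expR expR0 expR_lower ltr_pdivrMr; lra.
Qed.

Lemma upper_gt0 h : 0 < up h.
Proof.
have /andP[e1 e1'] := err1_bounds; have /andP[e2 e2'] := err2_bounds h.
by rewrite -oppr_lt0 -ltr_expR expR0 expRN_upper ltr_pdivrMr; lra.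
Qed.

(** The factor 2 absorbs the denominators [1 - err1] and [1 - err2], both at least [3/4]; it
    reappears in the weights of [error_left]. *)
Lemma expR_lower_le h : expR (low h) <= 2 * err2 s delta h.
Proof.
have /andP[e1 e1'] := err1_bounds; have /andP[e2 e2'] := err2_bounds h.
by rewrite expR_lower ler_pdivrMr; nra.
Qed.

Lemma expRN_upper_le h : expR (- up h) <= 2 * err1 n1 n2 delta.
Proof.
have /andP[e1 e1'] := err1_bounds; have /andP[e2 e2'] := err2_bounds h.
by rewrite expRN_upper ler_pdivrMr; nra.
Qed.

Lemma lowerN_le h : - low h <= ln (err2 s delta h)^-1.
Proof.
have /andP[e1 e1'] := err1_bounds; have /andP[e2 e2'] := err2_bounds h.
rewrite -ler_expR expRN expR_lower invf_div lnK ?posrE ?invr_gt0//.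
by rewrite ler_pdivrMr// mulVf ?gt_eqF//; lra.
Qed.

Lemma upper_le h : up h <= ln (err1 n1 n2 delta)^-1.
Proof.
have /andP[e1 e1'] := err1_bounds; have /andP[e2 e2'] := err2_bounds h.
have p : 0 < (1 - err2 s delta h) / err1 n1 n2 delta by apply: divr_gt0 => //; lra.
rewrite -ler_expR /upper !lnK ?posrE ?invr_gt0//.
by rewrite ler_pdivrMr// mulVf ?gt_eqF//; lra.
Qed.

(** These three costs bound the distance from [0] to the exit level of the true answer, plus the [6]
    of [walk_potential_le]. *)
Definition nonzero_test_cost : R := ln (8 * n / delta) + 6.
Definition search_test_cost : R := ln (4 / delta) + 6.
Definition refine_test_cost : R := ln (8 * s%:R / delta) + 6.

Lemma nonzero_test_cost_ge0 : 0 <= nonzero_test_cost.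
Proof.
numeric_facts; apply: addr_ge0 => //; apply: ln_ge0; rewrite ler_pdivlMr//; nra.
Qed.

Lemma search_test_cost_ge0 : 0 <= search_test_cost.
Proof. by numeric_facts; apply: addr_ge0 => //; apply: ln_ge0; rewrite ler_pdivlMr//; lra. Qed.

Lemma refine_test_cost_ge0 : 0 <= refine_test_cost.
Proof.
numeric_facts; apply: addr_ge0 => //; apply: ln_ge0; rewrite ler_pdivlMr//; nra.
Qed.

(** Worst-case remaining cost, in units where a measurement costs one drift. Non-zero coordinates
    are paid for whatever the phase, and the search reserves a full row and column in advance, so
    ending the search, even by a false positive, needs no new funds. *)
Definition precision_left h : R :=
  (unqueried (enum S) h)%:R * nonzero_test_cost +
  if nonzero_found h is Some c then (unqueried (refine c) h)%:R * refine_test_cost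
  else Num.max 0 (search_budget n1 n2 s delta - (size h)%:R) * search_test_cost +
       (n1 + n2)%:R * refine_test_cost.

Lemma precision_left_ge0 h : 0 <= precision_left h.
Proof.
have := nonzero_test_cost_ge0; have := search_test_cost_ge0; have := refine_test_cost_ge0.
move=> c1 c2 c3; rewrite /precision_left addr_ge0 ?mulr_ge0//.
by case: nonzero_found => [c|]; rewrite ?addr_ge0 ?mulr_ge0// le_max lexx.
Qed.

Definition test_cost h q : R := (if q \in S then up h else - low h) + 6.

Lemma size_refine c : (size (refine c) <= n1 + n2)%N.
Proof.
rewrite (perm_size (refineP c)) -cardE.
have sub : row_or_col c \subset
    ([set (c.1, j) | j : 'I_n2] :|: [set (i, c.2) | i : 'I_n1])%SET.
  apply/fintype.subsetP => -[i j]; rewrite !inE /= => /orP[/eqP ->|/eqP ->].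
    by apply/orP; left; apply/imsetP; exists j.
  by apply/orP; right; apply/imsetP; exists i.
apply: leq_trans (subset_leq_card sub) _; apply: leq_trans (leq_of_leqif (leq_card_setU _ _)) _.
by rewrite addnC leq_add// (leq_trans (leq_imset_card _ _))// card_ord.
Qed.

(** The answer [b] is arbitrary: tests that err are paid for too, and the precision bound needs no
    conditioning on correct answers. *)
Lemma precision_left_rcons order h q b : next order h = Some q ->
  precision_left (rcons h (q, b)) + test_cost h q <= precision_left h.
Proof.
move=> /next_queryP[nstop qh qL].
have c1 := nonzero_test_cost_ge0; have c2 := search_test_cost_ge0.
have c3 := refine_test_cost_ge0.
pose uS : R := (unqueried (enum S) h)%:R.
pose uS' : R := (unqueried (enum S) (rcons h (q, b)))%:R.
have uS'le : uS' <= uS by rewrite ler_nat unqueried_rcons_le.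
rewrite /precision_left -/uS -/uS' nonzero_found_rcons size_rcons.
set X' := (X in _ * _ + X + _ <= _); set X := (X in _ <= _ * _ + X).
(* A non-zero coordinate is charged to the first term, a zero coordinate to the
   term of the current phase. *)
have XX' : X' <= X /\ (q \notin S -> X' + (- low h + 6) <= X).
  have Nlow := lowerN_le h; move: nstop Nlow qL; rewrite /X /X' /stopped /err2.
  case: nonzero_found => [c|] /=.
    move=> _ Nlow qc; have := unqueried_rcons_lt b qc qh.
    rewrite -(ler_nat R) -natr1 => u1.
    have lc : - low h + 6 <= refine_test_cost.
      by rewrite lerD2r; apply: (le_trans Nlow); rewrite invf_div.
    by split=> [|_]; nra.
  rewrite negb_or -leNgt => /andP[_ Jh] Nlow _.
  have lc : - low h + 6 <= search_test_cost.
    by rewrite lerD2r; apply: (le_trans Nlow); rewrite invf_div.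
  move: Jh; rewrite -natr1; set J := search_budget _ _ _ _; set k := (size h)%:R => Jh.
  have k0 : 0 <= k by exact: ler0n.
  (* A run that is not stopped has [k + 1 <= J], so neither maximum is active and the query consumes
     exactly one unit of search budget. *)
  have -> : Num.max 0 (J - k) = J - k by apply: max_idPr; lra.
  have -> : Num.max 0 (J - (k + 1)) = J - (k + 1) by apply: max_idPr; lra.
  have u0 : (unqueried (refine q) (rcons h (q, b)))%:R * refine_test_cost
      <= (n1 + n2)%:R * refine_test_cost.
    rewrite ler_wpM2r// ler_nat (leq_trans (unqueried_size _ _))//.
    exact: size_refine.
  by move: u0; case: (b) => u0; split=> [|_]; nra.
rewrite /test_cost; case: ifP => qS; last first.
  by have := XX'.2 (negbT qS); nra.
have uS1 : uS' + 1 <= uS.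
  by rewrite natr1 ler_nat unqueried_rcons_lt// mem_enum.
have lc : up h + 6 <= nonzero_test_cost.
  by rewrite lerD2r; apply: (le_trans (upper_le h)); rewrite /err1 invf_div.
by have := XX'.1; nra.
Qed.

End procedure_steps.

(** * One-step drift of the potentials *)

Section run_steps.
Context (R : realType) (n1 n2 s : nat) (mu delta Gamma : R).
Context (refine : coordinate n1 n2 -> seq (coordinate n1 n2)).
Context (S : {set coordinate n1 n2}).
Hypothesis refineP : forall c, perm_eq (refine c) (enum (row_or_col c)).
Hypothesis n_gt0 : (0 < n1 * n2)%N.
Hypothesis s_gt0 : (0 < s)%N.
Hypothesis delta01 : 0 < delta < 1.
Hypothesis Gamma_gt0 : 0 < Gamma.

Implicit Types (h : history n1 n2) (q : coordinate n1 n2) (order : seq (coordinate n1 n2)).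
Implicit Types (x : history n1 n2 * R).

Local Notation next := (next_query s delta refine).
Local Notation low := (lower s delta).
Local Notation up := (upper s delta).
Local Notation gauss := (normal_prob (0 : R) 1).
Local Notation sigma := (mu * Num.sqrt Gamma).
Local Notation drift := (Gamma * mu ^+ 2 / 2).

Definition run_step order x (w : R) : history n1 n2 * R :=
  let: (h, z) := x in
  if next order h is Some q then
    let y := signal mu S q + (Num.sqrt Gamma)^-1 * w in
    let z' := z + log_likelihood_ratio mu Gamma y in
    if up h <= z' then (rcons h (q, true), 0)
    else if z' <= low h then (rcons h (q, false), 0)
    else (h, z')
  else (h, z).

Arguments run_step : simpl never.

Lemma run_step_stopped order x w : next order x.1 = None -> run_step order x w = x.
Proof. by case: x => h z /= E; rewrite /run_step E. Qed.

Lemma run_succ order (W : nat -> R) j :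
  run s mu delta Gamma refine order S W j.+1 =
  run_step order (run s mu delta Gamma refine order S W j) (W j).
Proof. by []. Qed.

Lemma run_stopped order (W : nat -> R) j k : (j <= k)%N ->
  next order (run s mu delta Gamma refine order S W j).1 = None ->
  run s mu delta Gamma refine order S W k = run s mu delta Gamma refine order S W j.
Proof.
move=> jk E; elim: k jk => [|k ih]; first by rewrite leqn0 => /eqP ->.
rewrite leq_eqVlt => /orP[/eqP -> //|]; rewrite ltnS => /ih jk.
by rewrite run_succ jk run_step_stopped.
Qed.

Lemma log_likelihood_ratioE y :
  log_likelihood_ratio mu Gamma y = Gamma * (mu * y - mu ^+ 2 / 2).
Proof.
have G0 : Gamma != 0 by rewrite gt_eqF.
have s0 : Num.sqrt Gamma^-1 != 0 by rewrite gt_eqF// sqrtr_gt0 invr_gt0.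
have p0 : normal_peak (Num.sqrt Gamma^-1) != 0 by rewrite gt_eqF// normal_peak_gt0.
rewrite /log_likelihood_ratio !normal_pdfE// invfM mulrACA divff// mul1r.
rewrite -expRN -expRD expRK sqr_sqrtr ?invr_ge0 ?ltW//.
by field.
Qed.

Definition sign_drift q : R := if q \in S then drift else - drift.

Lemma llr_measurement q w :
  log_likelihood_ratio mu Gamma (signal mu S q + (Num.sqrt Gamma)^-1 * w) =
  sigma * w + sign_drift q.
Proof.
rewrite log_likelihood_ratioE.
have r0 : Num.sqrt Gamma != 0 by rewrite gt_eqF// sqrtr_gt0.
have GE : Gamma = Num.sqrt Gamma * Num.sqrt Gamma by rewrite -expr2 sqr_sqrtr// ltW.
rewrite /signal /sign_drift; set r := Num.sqrt Gamma in r0 GE *.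
by case: ifP => _; rewrite GE; field.
Qed.

Lemma sigma_sqr : sigma ^+ 2 = 2 * drift.
Proof. by rewrite exprMn sqr_sqrtr ?ltW//; field. Qed.

Lemma measurable_run_step order h z d' (Y : measurableType d')
    (Phi : history n1 n2 * R -> Y) :
  (forall h', measurable_fun setT (fun z' => Phi (h', z'))) ->
  measurable_fun setT (fun w => Phi (run_step order (h, z) w)).
Proof.
move=> mPhi; rewrite /run_step; case: next => [q|//].
under eq_fun do rewrite llr_measurement.
have mz : measurable_fun [set: R] (fun w => z + (sigma * w + sign_drift q)).
  by apply: measurable_funD => //; apply: measurable_funD => //; exact: measurable_funM.
rewrite (_ : (fun w => _) = (fun w => if up h <= z + (sigma * w + sign_drift q)
    then Phi (rcons h (q, true), 0)
    else if z + (sigma * w + sign_drift q) <= low h then Phi (rcons h (q, false), 0)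
    else Phi (h, z + (sigma * w + sign_drift q)))); last first.
  by apply/funext => w; case: ifP => // _; case: ifP.
apply: measurable_fun_ifT => //; first exact: measurable_fun_ler.
apply: measurable_fun_ifT => //; first exact: measurable_fun_ler.
exact: (measurableT_comp (mPhi h) mz).
Qed.

(** * Precision potential *)

Definition distance h q (z : R) : R := if q \in S then up h - z else z - low h.

(* The running sum of a test in progress stays inside [(low, up)], so [+oo] is
   never reached by the run. *)
Definition precision_potential order x : \bar R :=
  if next order x.1 is Some q then
    if low x.1 < x.2 < up x.1 then
      (walk_potential (distance x.1 q x.2) +
       (precision_left s delta refine S x.1 - test_cost s delta S x.1 q))%:E
    else +oo%E
  else 0%E.

Definition measuring_cost order x : \bar R :=
  (if next order x.1 is Some _ then drift else 0)%:E.

Let left_le order h q b : next order h = Some q ->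
  precision_left s delta refine S (rcons h (q, b)) <=
  precision_left s delta refine S h - test_cost s delta S h q.
Proof. by move=> hq; rewrite lerBrDr (precision_left_rcons S refineP _ _ _ b hq). Qed.

Let left_ge0 h : 0 <= precision_left s delta refine S h.
Proof. exact: precision_left_ge0. Qed.

Lemma precision_potential_ge0 order x : (0 <= precision_potential order x)%E.
Proof.
rewrite /precision_potential; case E : next => [q|//]; case: ifP => // _.
rewrite lee_fin addr_ge0 ?walk_potential_ge0//.
exact: le_trans (left_ge0 _) (left_le true E).
Qed.

(** A new test starts at distance [test_cost - 6] from its exit level, so [walk_potential] at most
    gives back the [test_cost] that was subtracted. *)
Lemma precision_potential0_le order h :
  (precision_potential order (h, 0%R) <= (precision_left s delta refine S h)%:E)%E.
Proof.
rewrite /precision_potential /=; case E : next => [q|]; last by rewrite lee_fin.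
have l0 := lower_lt0 n_gt0 s_gt0 delta01 h; have u0 := upper_gt0 n_gt0 s_gt0 delta01 h.
rewrite l0 u0 lee_fin.
have d0 : 0 <= distance h q 0 by rewrite /distance; case: ifP; lra.
have := walk_potential_le d0; rewrite /test_cost /distance; case: ifP; lra.
Qed.

Lemma measurable_precision_potential order h :
  measurable_fun setT (fun z : R => precision_potential order (h, z)).
Proof.
rewrite /precision_potential /=; case: next => [q|//].
apply: measurable_fun_ifT => //.
  by apply: measurable_and => //; exact: measurable_fun_ltr.
apply/measurable_EFinP/measurable_funD => //.
have md : measurable_fun [set: R] (distance h q).
  by rewrite /distance; case: (q \in S); exact: measurable_funB.
exact: (measurableT_comp (@measurable_walk_potential R) md).
Qed.

(** During a test the potential follows the walk. On exit, on either side and with any overshoot,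
    the new potential is at most [B] while [walk_potential] is non-negative; so the walk potential
    plus [B] dominates pointwise. *)
Lemma precision_potential_drift order x : drift <= 12^-1 ->
  (measuring_cost order x + \int[gauss]_w precision_potential order (run_step order x w)
    <= precision_potential order x)%E.
Proof.
case: x => h z drift_le; have d0 : 0 <= drift by rewrite divr_ge0// mulr_ge0 ?sqr_ge0// ltW.
rewrite /measuring_cost {2}/precision_potential /=.
case E : next => [q|]; last first.
  rewrite add0e; under eq_integral do rewrite run_step_stopped// /precision_potential /= E.
  by rewrite integral0.
case: ifP => [/andP[lz zu]|_]; last by rewrite leey.
set B := _ - test_cost _ _ _ _ _.
(* The distance to the exit level of the true answer drifts by [- drift] in both cases; only the
   sign of the noise coefficient changes. *)
pose sg := if q \in S then - sigma else sigma.
have sgE : sg ^+ 2 = 2 * drift by rewrite /sg; case: ifP; rewrite ?sqrrN sigma_sqr.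
have dz : 0 <= distance h q z by rewrite /distance; case: ifP; lra.
suff I : (\int[gauss]_w precision_potential order (run_step order (h, z) w) <=
   \int[gauss]_w (walk_potential (distance h q z + (sg * w - drift)) + B)%:E)%E.
  have d01 : 0 <= drift <= 12^-1 by rewrite d0 drift_le.
  apply: (@le_trans _ _ (drift%:E + (walk_potential (distance h q z) - drift + B)%:E)%E).
    by apply: leeD2l; apply: le_trans I _; exact: integral_walk_potential.
  by rewrite -EFinD lee_fin; lra.
have B0 b : precision_left s delta refine S (rcons h (q, b)) <= B by exact: left_le E.
have B_ge0 : 0 <= B by exact: le_trans (left_ge0 _) (B0 true).
have mw : measurable_fun [set: R] (fun w => distance h q z + (sg * w - drift)).
  by apply: measurable_funD => //; apply: measurable_funB => //; exact: measurable_funM.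
have mV := measurableT_comp (@measurable_walk_potential R) mw.
have mVB := measurable_funD mV (measurable_cst B).
apply: ge0_le_integral => //.
- by move=> w _; exact: precision_potential_ge0.
- by apply: measurable_run_step; exact: measurable_precision_potential.
- by move/measurable_EFinP : mVB.
- move=> w _; rewrite /run_step E llr_measurement.
  set z' := z + _.
  have -> : distance h q z + (sg * w - drift) = distance h q z'.
    by rewrite /distance /sg /z' /sign_drift; case: ifP => _; ring.
  have V0 := walk_potential_ge0 (distance h q z').
  have [uz'|z'u] := leP (up h) z'.
    apply: le_trans (precision_potential0_le _ _) _; rewrite lee_fin.
    by have := B0 true; lra.
  have [z'l|lz'] := leP z' (low h).
    apply: le_trans (precision_potential0_le _ _) _; rewrite lee_fin.
    by have := B0 false; lra.
  by rewrite /precision_potential /= E lz' z'u.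
Qed.

(** * Error potential *)

Definition correct h : bool := all (fun qa => qa.2 == (qa.1 \in S)) h.

(** A union bound over future tests, each weighing twice its target error. During the search a
    correct answer on [S] ends the phase, so the larger error [delta / 4] is charged only once, as
    [delta / 2]. *)
Definition error_left h : R :=
  (unqueried (enum (~: S)%SET) h)%:R * (delta / (4 * (n1 * n2)%:R)) +
  (unqueried (enum S) h)%:R * (delta / (4 * s%:R)) +
  (if nonzero_found h is Some _ then 0 else delta / 2).

Definition exit_exponent h q (z : R) : R := if q \in S then low h - z else z - up h.

(* Bounds the probability that some answer is eventually wrong. The exponential is
   the likelihood-ratio martingale of the current test, at least [1] where that
   test would return the wrong answer. *)
Definition error_potential order x : \bar R :=
  if correct x.1 then
    if next order x.1 is Some q then
      (expR (exit_exponent x.1 q x.2) + error_left (rcons x.1 (q, q \in S)))%:E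
    else 0%E
  else 1%E.

Let delta_gt0 : 0 < delta. Proof. by case/andP: delta01. Qed.

Lemma error_left_ge0 h : 0 <= error_left h.
Proof.
have d0 := ltW delta_gt0.
rewrite /error_left !addr_ge0 ?mulr_ge0 ?invr_ge0//.
by case: nonzero_found => [c|] //; apply: divr_ge0.
Qed.

Lemma error_left_rcons order h q : next order h = Some q ->
  expR (exit_exponent h q 0) + error_left (rcons h (q, q \in S)) <= error_left h.
Proof.
move=> /next_queryP[_ qh _]; rewrite /error_left /exit_exponent.
have d0 := ltW delta_gt0.
have lexp := expR_lower_le n_gt0 s_gt0 delta01 h.
have uexp := expRN_upper_le n_gt0 s_gt0 delta01 h.
have n0 : 0 < (n1 * n2)%:R :> R by rewrite ltr0n.
have s0 : 0 < s%:R :> R by rewrite ltr0n.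
pose a := delta / (4 * (n1 * n2)%:R); pose b := delta / (4 * s%:R).
have a0 : 0 <= a by rewrite divr_ge0// mulr_ge0// ltW.
have b0 : 0 <= b by rewrite divr_ge0// mulr_ge0// ltW.
rewrite -/a -/b.
have aE : 2 * err1 n1 n2 delta = a 
  by rewrite /err1 /a !invfM; move: ((n1 * n2)%:R^-1) => v; field.
have bE : 2 * (delta / (8 * s%:R)) = b by rewrite /b !invfM; move: (s%:R^-1) => v; field.
have le1 := unqueried_rcons_le (enum S) h q (q \in S).
have le2 := unqueried_rcons_le (enum (~: S)%SET) h q (q \in S).
case: ifPn => qS.
  have lt1 : (unqueried (enum S) (rcons h (q, q \in S)) < unqueried (enum S) h)%N.
    by rewrite unqueried_rcons_lt// mem_enum.
  move: lt1 le2; rewrite qS -!(ler_nat R) -natr1 => lt1 le2.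
  rewrite subr0 nonzero_found_rcons; move: lexp; rewrite /err2.
  case: nonzero_found => [c|] /=; first by rewrite bE; nra.
  by nra.
have lt2 : (unqueried (enum (~: S)%SET) (rcons h (q, q \in S))
            < unqueried (enum (~: S)%SET) h)%N.
  by rewrite unqueried_rcons_lt// mem_enum inE.
move: lt2 le1; rewrite (negbTE qS) -!(ler_nat R) -natr1 => lt2 le1.
rewrite sub0r nonzero_found_rcons.
case: nonzero_found => [c|] /=; nra.
Qed.

Lemma error_potential_ge0 order x : (0 <= error_potential order x)%E.
Proof.
rewrite /error_potential; case: correct; last by rewrite lee_fin.
by case: next => [q|//]; rewrite lee_fin addr_ge0 ?expR_ge0 ?error_left_ge0.
Qed.

Lemma error_potential0_le order h : correct h ->
  (error_potential order (h, 0%R) <= (error_left h)%:E)%E.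
Proof.
move=> hc; rewrite /error_potential /= hc; case E : next => [q|].
  by rewrite lee_fin (error_left_rcons E).
by rewrite lee_fin error_left_ge0.
Qed.

Lemma correct_rcons h q b : correct (rcons h (q, b)) = (b == (q \in S)) && correct h.
Proof. by rewrite /correct all_rcons. Qed.

Lemma measurable_error_potential order h :
  measurable_fun setT (fun z : R => error_potential order (h, z)).
Proof.
rewrite /error_potential /=; case: correct => //; case: next => [q|//].
have me : measurable_fun [set: R] (exit_exponent h q).
  by rewrite /exit_exponent; case: (q \in S); exact: measurable_funB.
have mE := measurableT_comp (@measurable_expR R) me.
have := measurable_funD mE (measurable_cst (error_left (rcons h (q, q \in S)))).
by move/measurable_EFinP.
Qed.

(** A wrong answer freezes the potential at [1], and is given only where the exponent is
    non-negative, hence where the exponential is at least [1]. A correct answer leaves at most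
    [L]. *)
Lemma error_potential_drift order x :
  (\int[gauss]_w error_potential order (run_step order x w)
    <= error_potential order x)%E.
Proof.
case: x => h z; rewrite [leRHS]/error_potential /=; case: ifPn => hc; last first.
  have h1 w : error_potential order (run_step order (h, z) w) = 1%E.
    rewrite /run_step; case: next => [q|]; last by rewrite /error_potential /= (negbTE hc).
    by case: ifP => _; [|case: ifP => _];
      rewrite /error_potential /= ?correct_rcons (negbTE hc) ?andbF.
  under eq_integral do rewrite h1.
  have -> : (\int[gauss]_w 1 = 1 * gauss setT)%E by exact: integral_cst.
  by rewrite (@probability_setT _ _ _ gauss) mule1.
case E : next => [q|]; last first.
  under eq_integral do rewrite run_step_stopped// /error_potential /= E hc.
  by rewrite integral0.
set L := error_left _.
pose sg := if q \in S then - sigma else sigma.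
have sgE : sg ^+ 2 = 2 * drift by rewrite /sg; case: ifP; rewrite ?sqrrN sigma_sqr.
rewrite -(integral_exp_martingale (exit_exponent h q z) L sgE).
have mw : measurable_fun [set: R] (fun w => exit_exponent h q z + (sg * w - drift)).
  by apply: measurable_funD => //; apply: measurable_funB => //; exact: measurable_funM.
have mE := measurableT_comp (@measurable_expR R) mw.
have mEL := measurable_funD mE (measurable_cst L).
apply: ge0_le_integral => //.
- by move=> w _; exact: error_potential_ge0.
- by apply: measurable_run_step; exact: measurable_error_potential.
- by move/measurable_EFinP : mEL.
- move=> w _; rewrite /run_step E llr_measurement.
  set z' := z + _.
  have -> : exit_exponent h q z + (sg * w - drift) = exit_exponent h q z'.
    by rewrite /exit_exponent /sg /z' /sign_drift; case: ifP => _; ring.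
  have L0 : 0 <= L by exact: error_left_ge0.
  have lu : low h < up h.
    by rewrite (lt_trans (lower_lt0 _ _ _ h))// (upper_gt0 _ _ _ h).
  have good b : b = (q \in S) ->
      (error_potential order (rcons h (q, b), 0%R) <=
       (expR (exit_exponent h q z') + L)%:E)%E.
    move=> bE; apply: le_trans (error_potential0_le _ _) _.
      by rewrite correct_rcons bE eqxx.
    by rewrite lee_fin bE lerDr expR_ge0.
  have bad b : b <> (q \in S) -> 0 <= exit_exponent h q z' ->
      (error_potential order (rcons h (q, b), 0%R) <=
       (expR (exit_exponent h q z') + L)%:E)%E.
    move=> /eqP bN e0; rewrite /error_potential /= correct_rcons (negbTE bN) lee_fin.
    by have := expR_ge1Dx (exit_exponent h q z'); lra.
  have [uz'|z'u] := leP (up h) z'.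
    case qS : (q \in S); first by apply: good; rewrite qS.
    by apply: bad; rewrite ?qS// /exit_exponent qS; lra.
  have [z'l|lz'] := leP z' (low h).
    case qS : (q \in S); last by apply: good; rewrite qS.
    by apply: bad; rewrite ?qS// /exit_exponent qS; lra.
  by rewrite /error_potential /= hc E.
Qed.

End run_steps.

(** * The run on the sensing model *)

(** The discrete part of the state. Keeping the permutation here makes the random search order a
    function of the state; the type is countable and carries the discrete sigma-algebra. *)
Definition run_record (n1 n2 : nat) : Type :=
  ({perm coordinate n1 n2} * seq (coordinate n1 n2 * bool))%type.

Section run_record_measurable.
Context (n1 n2 : nat).
HB.instance Definition _ := Countable.on (run_record n1 n2).
HB.instance Definition _ := isPointed.Build (run_record n1 n2) (1%g, [::]).
HB.instance Definition _ := @isMeasurable.Build default_measure_display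
  (run_record n1 n2) discrete_measurable discrete_measurable0
  discrete_measurableC discrete_measurableU.
End run_record_measurable.

(* [normal_prob] lives on [measurableTypeR R], whose measurable sets are those of
   [R] but whose display differs from the one of [R]; this is its copy on [R]. *)
Section standard_gaussian.
Context (R : realType).
Local Notation normal := (normal_prob (0 : R) 1).

Let measurable_real_id : measurable_fun [set: measurableTypeR R] (fun y => y : R).
Proof. by move=> _ B mB; rewrite setTI. Qed.

Let real_id : {mfun (measurableTypeR R) >-> R} :=
  HB.pack (fun y : measurableTypeR R => y : R)
    (isMeasurableFun.Build _ _ _ _ _ measurable_real_id).

Definition standard_gaussian : probability R R := distribution normal real_id.

Lemma ge0_integral_standard_gaussian (f : R -> \bar R) : measurable_fun [set: R] f ->
  (forall y, 0 <= f y)%E -> (\int[standard_gaussian]_y f y = \int[normal]_y f y)%E.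
Proof. by move=> mf f0; rewrite ge0_integral_distribution. Qed.

End standard_gaussian.

Section model.
Context (R : realType) (n1 n2 s : nat) (mu delta Gamma : R).
Context (refine : coordinate n1 n2 -> seq (coordinate n1 n2)).
Context (M : sensing_model R n1 n2) (S : {set coordinate n1 n2}).
Hypothesis refineP : forall c, perm_eq (refine c) (enum (row_or_col c)).
Hypothesis n_gt0 : (0 < n1 * n2)%N.
Hypothesis s_gt0 : (0 < s)%N.
Hypothesis delta01 : 0 < delta < 1.
Hypothesis mu_gt0 : 0 < mu.
Hypothesis Gamma_gt0 : 0 < Gamma.

Local Notation P := (sm_prob M S).
Local Notation gauss := (normal_prob (0 : R) 1).
Local Notation state := (run_record n1 n2 * R)%type.
Local Notation drift := (Gamma * mu ^+ 2 / 2).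
Local Notation next := (next_query s delta refine).

Definition listing (p : {perm coordinate n1 n2}) : seq (coordinate n1 n2) :=
  [seq p q | q <- enum (coordinate n1 n2)].

Definition state_at (w : sm_space M) (j : nat) : history n1 n2 * R :=
  run s mu delta Gamma refine (search_order w) S (fun i => sm_noise M i w) j.

Definition chain (j : nat) (w : sm_space M) : state :=
  ((sm_perm w, (state_at w j).1), (state_at w j).2).

Definition chain_step (x : state * R) : state :=
  let y := run_step s mu delta Gamma refine S (listing x.1.1.1) (x.1.1.2, x.1.2) x.2 in
  ((x.1.1.1, y.1), y.2).

Lemma chain_succ j w : chain j.+1 w = chain_step (chain j w, sm_noise M j w).
Proof.
rewrite /chain /chain_step.
have -> : state_at w j.+1 = run_step s mu delta Gamma refine S (listing (sm_perm w))
    (state_at w j) (sm_noise M j w) by [].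
by case: (state_at w j).
Qed.

(** Cut along the countably many values of the discrete part, the step is a piecewise explicit
    function of two reals. *)
Lemma measurable_chain_step : measurable_fun setT chain_step.
Proof.
apply: (@measurable_fun_countable_cases _ _ _ _ _ (run_record n1 n2) pickle
  (fun x => x.1.1)) => //.
- exact: (measurableT_comp measurable_fst measurable_fst).
move=> [p h].
pose F (x : state * R) : state :=
  let y := run_step s mu delta Gamma refine S (listing p) (h, x.1.2) x.2 in
  ((p, y.1), y.2).
apply: (eq_measurable_fun F).
  by move=> [[[p' h'] z] w]; rewrite inE => -[-> ->].
apply: measurable_funTS; rewrite /F /run_step.
case E : next => [q|]; last first.
  apply: measurable_fun_pair => //=.
  exact: (measurableT_comp measurable_snd measurable_fst).
have mz : measurable_fun setT (fun x : state * R => x.1.2 +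
    (mu * Num.sqrt Gamma * x.2 + sign_drift mu Gamma S q)).
  apply: measurable_funD.
    exact: (measurableT_comp measurable_snd measurable_fst).
  by apply: measurable_funD => //; exact: measurable_funM.
under eq_fun do rewrite llr_measurement//.
pose Z (x : state * R) := x.1.2 +
    (mu * Num.sqrt Gamma * x.2 + sign_drift mu Gamma S q).
rewrite (_ : (fun x => _) = (fun x => if upper s delta h <= Z x
    then ((p, rcons h (q, true)), 0)
    else if Z x <= lower s delta h then ((p, rcons h (q, false)), 0)
    else ((p, h), Z x))); last first.
  by apply/funext => x; rewrite -/(Z x); case: ifP => // _; case: ifP.
apply: measurable_fun_ifT => //; first exact: measurable_fun_ler.
apply: measurable_fun_ifT => //; first exact: measurable_fun_ler.
exact: measurable_fun_pair.
Qed.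

Lemma measurable_sm_perm_preimage (A : set {perm coordinate n1 n2}) :
  measurable ((@sm_perm _ _ _ M) @^-1` A).
Proof.
have -> : (@sm_perm _ _ _ M) @^-1` A =
    \bigcup_(p in A) ((@sm_perm _ _ _ M) @^-1` [set p]).
  apply/seteqP; split => [w Aw|w [p Ap /= wp]]; first by exists (sm_perm w).
  by rewrite /preimage /= wp.
apply: fin_bigcup_measurable; first exact: finite_finset.
by move=> p _; exact: sm_perm_measurable.
Qed.

Lemma measurable_chain0 : measurable_fun setT (chain 0).
Proof.
apply: measurable_fun_pair => //= _ B _; rewrite setTI.
exact: (measurable_sm_perm_preimage [set p | B (p, [::])]).
Qed.

Lemma sm_perm_set_law (A : set {perm coordinate n1 n2}) k (B : nat -> set R) :
  (forall i, measurable (B i)) ->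
  P ((@sm_perm _ _ _ M) @^-1` A `&` \bigcap_(j in `I_k) (sm_noise M j @^-1` B j)) =
  (#|[pred p | p \in A]|%:R * #|{perm coordinate n1 n2}|%:R^-1 *
   \prod_(j < k) fine (gauss (B j)))%:E.
Proof.
move=> mB.
have mF : measurable (\bigcap_(j in `I_k) (sm_noise M j @^-1` B j)).
  apply: bigcap_measurableType => i _.
  by rewrite -[X in measurable X]setTI; exact: measurable_funPT.
have -> : (@sm_perm _ _ _ M) @^-1` A `&` \bigcap_(j in `I_k) (sm_noise M j @^-1` B j) =
    \bigcup_(p in A) ((@sm_perm _ _ _ M) @^-1` [set p] `&`
      \bigcap_(j in `I_k) (sm_noise M j @^-1` B j)).
  rewrite -setI_bigcupl; congr (_ `&` _).
  apply/seteqP; split => [w Aw|w [p Ap /= wp]]; first by exists (sm_perm w).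
  by rewrite /preimage /= wp.
rewrite measure_fin_bigcup//; last 3 first.
- exact: finite_finset.
- by move=> p p' _ _ [w [[/= <- _] [/= <- _]]].
- by move=> p _; apply: measurableI => //; exact: sm_perm_measurable.
transitivity (\sum_(p \in A) (#|{perm coordinate n1 n2}|%:R^-1 *
    \prod_(j < k) fine (gauss (B j)))%:E)%E.
  by apply: eq_fsbigr => p _; exact: sm_law.
have AE : A = [set` enum [pred p | p \in A]].
  apply/seteqP; split => p /= => [Ap|]; first by rewrite mem_enum !inE.
  by rewrite mem_enum !inE.
rewrite {1}AE -fsbig_seq ?enum_uniq// sumEFin big_const_seq count_predT iter_addr_0 -cardE.
by congr EFin; rewrite -[LHS]mulr_natl mulrA.
Qed.

Lemma chain0_indep A k (B : nat -> set R) : measurable A ->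
  (forall i, measurable (B i)) ->
  P (chain 0 @^-1` A `&` \bigcap_(i in `I_k) (sm_noise M i @^-1` B i)) =
  (P (chain 0 @^-1` A) * (\prod_(i < k) fine (gauss (B i)))%:E)%E.
Proof.
move=> _ mB; pose Q := [set p | A ((p, [::]), 0)].
have -> : chain 0 @^-1` A = (@sm_perm _ _ _ M) @^-1` Q by [].
rewrite sm_perm_set_law//.
have := @sm_perm_set_law Q 0 B mB; rewrite big_ord0 mulr1.
rewrite (_ : \bigcap_(j in `I_0) _ = setT); last by apply/seteqP; split.
by rewrite setIT => ->; rewrite EFinM.
Qed.

Lemma measurable_state_fun d' (Y : measurableType d') (F : state -> Y) :
  (forall p h, measurable_fun setT (fun z : R => F ((p, h), z))) ->
  measurable_fun setT F.
Proof.
move=> mF; apply: (@measurable_fun_countable_cases _ _ _ _ _ (run_record n1 n2) pickle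
  fst) => //.
move=> [p h]; apply: (eq_measurable_fun (fun x => F ((p, h), x.2))).
  by move=> [[p' h'] z]; rewrite inE => -[-> ->].
by apply: measurable_funTS; exact: (measurableT_comp (mF p h) measurable_snd).
Qed.

Lemma measurable_chain_fun d' (Y : measurableType d')
    (F : seq (coordinate n1 n2) -> history n1 n2 * R -> Y) j :
  (forall order h, measurable_fun setT (fun z : R => F order (h, z))) ->
  measurable_fun setT (fun w => F (search_order w) (state_at w j)).
Proof.
move=> mF.
have mG : measurable_fun setT (fun x : state => F (listing x.1.1) (x.1.2, x.2)).
  by apply: measurable_state_fun => p h; exact: (mF (listing p) h).
have := measurableT_comp mG (measurable_chain measurable_chain_step measurable_chain0
  chain_succ j).
apply: eq_measurable_fun => w _ /=; congr (F _ _).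
by rewrite -surjective_pairing.
Qed.

(** The drift is checked for each fixed [order], and the conclusion holds for the random one,
    because [order] is read from the unchanging permutation in the state. *)
Lemma run_supermartingale (F c : seq (coordinate n1 n2) -> history n1 n2 * R -> \bar R) k :
  (forall order h, measurable_fun setT (fun z : R => F order (h, z))) ->
  (forall order h, measurable_fun setT (fun z : R => c order (h, z))) ->
  (forall order x, 0 <= F order x)%E -> (forall order x, 0 <= c order x)%E ->
  (forall order x, c order x +
     \int[gauss]_y F order (run_step s mu delta Gamma refine S order x y)
     <= F order x)%E ->
  (\sum_(j < k) \int[P]_w c (search_order w) (state_at w j) +
   \int[P]_w F (search_order w) (state_at w k)
    <= \int[P]_w F (search_order w) ([::], 0%R))%E.
Proof.
move=> mF mc F0 c0 Fdrift.
pose G (x : state) := F (listing x.1.1) (x.1.2, x.2).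
pose e (x : state) := c (listing x.1.1) (x.1.2, x.2).
have mG : measurable_fun [set: state] G.
  by apply: measurable_state_fun => p h; exact: (mF (listing p) h).
have me : measurable_fun [set: state] e.
  by apply: measurable_state_fun => p h; exact: (mc (listing p) h).
have GE j w : F (search_order w) (state_at w j) = G (chain j w).
  by rewrite /G /chain /= -surjective_pairing.
have eE j w : c (search_order w) (state_at w j) = e (chain j w).
  by rewrite /e /chain /= -surjective_pairing.
have intF j : (\int[P]_w F (search_order w) (state_at w j) = \int[P]_w G (chain j w))%E.
  by apply: eq_integral => w _; exact: GE.
have intc j : (\int[P]_w c (search_order w) (state_at w j) = \int[P]_w e (chain j w))%E.
  by apply: eq_integral => w _; exact: eE.
rewrite -[leRHS]/(\int[P]_w F (search_order w) (state_at w 0))%E !intF.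
under eq_bigr do rewrite intc.
have key := integral_chain_le (gamma := standard_gaussian R) measurable_chain_step measurable_chain0
  chain_succ chain0_indep k mG me (fun x => F0 _ _) (fun x => c0 _ _).
apply: key => -[[p h] z].
apply: le_trans (Fdrift (listing p) (h, z)).
apply: leeD2l; rewrite le_eqVlt; apply/orP; left; apply/eqP.
rewrite ge0_integral_standard_gaussian; last 2 first.
- exact: (measurableT_comp mG (measurableT_comp measurable_chain_step
    (@pair1_measurable _ _ state R ((p, h), z)))).
- by move=> y; exact: F0.
by apply: eq_integral => y _; rewrite /G /chain_step /= -surjective_pairing.
Qed.

(** * Bounds on the run obtained from the potentials *)

Lemma measurable_measuring_cost order h :
  measurable_fun setT (fun z : R => measuring_cost s mu delta Gamma refine order (h, z)).
Proof. by rewrite /measuring_cost /=. Qed.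

Lemma measuring_cost_ge0 order (x : history n1 n2 * R) :
  (0 <= measuring_cost s mu delta Gamma refine order x)%E.
Proof.
rewrite /measuring_cost lee_fin; case: next => // _.
by rewrite divr_ge0// mulr_ge0 ?sqr_ge0// ltW.
Qed.

Lemma le_integral_probability (f : sm_space M -> \bar R) (b : R) :
  measurable_fun [set: sm_space M] f ->
  (forall w, 0 <= f w)%E -> (forall w, f w <= b%:E)%E -> (\int[P]_w f w <= b%:E)%E.
Proof.
move=> mf f0 fb; have -> : b%:E = (\int[P]_w b%:E)%E.
  have -> : (\int[P]_w b%:E = b%:E * P setT)%E by exact: integral_cst.
  by rewrite probability_setT mule1.
by apply: ge0_le_integral.
Qed.

Lemma sum_measuring_cost_le k : drift <= 12^-1 ->
  (\sum_(j < k) \int[P]_w measuring_cost s mu delta Gamma refine (search_order w) (state_at w j)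
    <= (precision_left s delta refine S [::])%:E)%E.
Proof.
move=> drift_le.
have F0 order x : (0 <= precision_potential s delta refine S order x)%E.
  exact: precision_potential_ge0.
have mF order h :
    measurable_fun setT (fun z : R => precision_potential s delta refine S order (h, z)).
  exact: measurable_precision_potential.
have Fd order x : (measuring_cost s mu delta Gamma refine order x +
    \int[gauss]_y precision_potential s delta refine S order
       (run_step s mu delta Gamma refine S order x y)
    <= precision_potential s delta refine S order x)%E.
  exact: precision_potential_drift.
have H := run_supermartingale k mF measurable_measuring_cost F0 measuring_cost_ge0 Fd.
apply: le_trans (le_trans H _); first by rewrite leeDl// integral_ge0.
apply: le_integral_probability => //.
  exact: (@measurable_chain_fun _ _ (precision_potential s delta refine S) 0).
by move=> w; exact: precision_potential0_le.
Qed.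

(** A measurement uses [Gamma = (2 / mu^2) * drift], which removes [Gamma] from the bound; the bound
    on partial sums is uniform in [k] and passes to the series. *)
Lemma expected_precision_le : drift <= 12^-1 ->
  (expected_precision s mu delta Gamma refine M S
    <= (2 / mu ^+ 2 * precision_left s delta refine S [::])%:E)%E.
Proof.
move=> drift_le; have mu20 : 0 <= 2 / mu ^+ 2 by rewrite divr_ge0 ?sqr_ge0.
pose c j w := measuring_cost s mu delta Gamma refine (search_order w) (state_at w j).
have mc j : measurable_fun setT (c j).
  exact: (measurable_chain_fun j measurable_measuring_cost).
have c0 j w : (0 <= c j w)%E by exact: measuring_cost_ge0.
have E w : precision_used s mu delta Gamma refine S w =
    (\sum_(0 <= j <oo) (2 / mu ^+ 2)%:E * c j w)%E.
  apply: eq_eseriesr => j _; rewrite /c /measuring_cost -EFinM /measured.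
  rewrite -[(run _ _ _ _ _ _ _ _ j).1]/(state_at w j).1.
  case: next_query => [q|]; last by rewrite mulr0.
  by congr EFin; field; rewrite gt_eqF.
rewrite /expected_precision; under eq_integral do rewrite E.
rewrite integral_nneseries//; last 2 first.
- by move=> j; apply: emeasurable_funM.
- by move=> j w _; rewrite mule_ge0// lee_fin.
apply: lime_le.
  by apply: is_cvg_nneseries => j _ _; apply: integral_ge0 => w _; rewrite mule_ge0// lee_fin.
apply: nearW => k; rewrite big_mkord.
under eq_bigr do rewrite ge0_integralZl_EFin//.
rewrite -ge0_sume_distrr; last by move=> j _; exact: integral_ge0.
by rewrite [leRHS]EFinM; apply: lee_wpmul2l; [rewrite lee_fin|exact: sum_measuring_cost_le].
Qed.

Lemma measurable_history_event (H : seq (coordinate n1 n2) -> history n1 n2 -> bool) j :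
  measurable [set w | H (search_order w) (state_at w j).1].
Proof.
have m : measurable_fun setT (fun w => H (search_order w) (state_at w j).1).
  apply: (@measurable_chain_fun _ bool (fun order x => H order x.1)) => order h /=.
  exact: measurable_cst.
by rewrite -[X in measurable X]setTI; apply: (m measurableT [set true]).
Qed.

(** The potential equals [1] on incorrect histories, so its expectation dominates their
    probability. *)
Lemma incorrect_probability_le k :
  (P [set w | ~~ correct S (state_at w k).1] <= (error_left s delta S [::])%:E)%E.
Proof.
have F0 order x : (0 <= error_potential s delta refine S order x)%E.
  exact: error_potential_ge0.
have mF order h :
    measurable_fun setT (fun z : R => error_potential s delta refine S order (h, z)).
  exact: measurable_error_potential.
have := @run_supermartingale _ (fun _ _ => 0%E) k mF (fun _ _ => measurable_cst _) F0
  (fun _ _ => lexx _).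
rewrite big1 ?add0e; last by move=> j _; exact: integral0.
move=> H; have {}H := H (fun order x => _).
set A := [set w | _].
have mA : measurable A by exact: (measurable_history_event (fun _ h => ~~ correct S h)).
have <- : (\int[P]_w (\1_A w)%:E = P A)%E by rewrite integral_indic// setIT.
apply: (@le_trans _ _
  (\int[P]_w error_potential s delta refine S (search_order w) (state_at w k))%E).
  apply: ge0_le_integral => //.
  - exact/measurable_EFinP/measurable_indic.
  - exact: measurable_chain_fun.
  - move=> w _; rewrite indicE; case: (boolP (w \in A)) => //; rewrite inE /A /= => Aw.
    by rewrite /error_potential (negbTE Aw).
apply: (le_trans (H _)).
  by move=> order x; rewrite add0e; exact: error_potential_drift.
apply: le_integral_probability => //.
  exact: (@measurable_chain_fun _ _ (error_potential s delta refine S) 0).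
by move=> w; exact: error_potential0_le.
Qed.

Lemma state_at_stopped w j k : (j <= k)%N ->
  next (search_order w) (state_at w j).1 = None -> state_at w k = state_at w j.
Proof. exact: run_stopped. Qed.

(** A run still active at time [k] was active at every earlier time, hence has paid [k] times the
    drift. *)
Lemma unstopped_probability_le k : drift <= 12^-1 ->
  ((k%:R * drift)%:E * P [set w | next (search_order w) (state_at w k).1 != None]
    <= (precision_left s delta refine S [::])%:E)%E.
Proof.
move=> drift_le; apply: le_trans (sum_measuring_cost_le k drift_le).
set A := [set w | _].
have mA : measurable A.
  exact: (measurable_history_event (fun order h => next order h != None)).
have d0 : 0 <= drift by rewrite divr_ge0// mulr_ge0 ?sqr_ge0// ltW.
have <- : (\int[P]_w (\1_A w)%:E = P A)%E by rewrite integral_indic// setIT.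
rewrite EFinM -muleA -ge0_integralZl_EFin//; last first.
  exact/measurable_EFinP/measurable_indic.
set I := (\int[P]__ _)%E.
have -> : (k%:R%:E * I = \sum_(j < k) I)%E by rewrite sumr_const card_ord mule_natl.
apply: lee_sum => j _.
apply: ge0_le_integral => //.
- by move=> w _; rewrite mule_ge0 ?lee_fin.
- by apply: emeasurable_funM => //; exact/measurable_EFinP/measurable_indic.
- exact: (measurable_chain_fun j measurable_measuring_cost).
- move=> w _; rewrite indicE; case: (boolP (w \in A)); last by rewrite mule0 measuring_cost_ge0.
  rewrite inE /A /= => Aw; rewrite mule1 /measuring_cost.
  case E : (next_query _ _ _ _ _) => [//|].
  by move: Aw; rewrite (state_at_stopped (ltnW (ltn_ord j)) E) E.
Qed.

End model.

(** * Recovery of the support from correct answers *)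

Section estimator_correctness.
Context (R : realType) (n1 n2 s : nat) (mu delta Gamma : R).
Context (refine : coordinate n1 n2 -> seq (coordinate n1 n2)).
Context (order : seq (coordinate n1 n2)) (S : {set coordinate n1 n2}) (W : nat -> R).
Hypothesis refineP : forall c, perm_eq (refine c) (enum (row_or_col c)).
Hypothesis s_gt0 : (0 < s)%N.
Hypothesis order_uniq : uniq order.
Hypothesis mem_order : forall c, c \in order.
Hypothesis S_sub : S \in submatrices n1 n2 s.

Implicit Types (h : history n1 n2) (q c : coordinate n1 n2).

Local Notation next := (next_query s delta refine order).
Local Notation state := (run s mu delta Gamma refine order S W).

Lemma submatrixP (A : {set coordinate n1 n2}) : A \in submatrices n1 n2 s ->
  exists A1 A2, A = finset.setX A1 A2 /\ (#|A1| * #|A2| = s)%N.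
Proof.
rewrite inE => /existsP[A1 /existsP[A2 /andP[/eqP -> /eqP sE]]].
by exists A1, A2.
Qed.

Lemma submatrix_card (A : {set coordinate n1 n2}) : A \in submatrices n1 n2 s -> #|A| = s.
Proof. by move=> /submatrixP[A1 [A2 [-> <-]]]; rewrite cardsX. Qed.

(** Through a common element, its column reads off the first factor and its row the second. *)
Lemma submatrix_eq (A B : {set coordinate n1 n2}) c :
  A \in submatrices n1 n2 s -> B \in submatrices n1 n2 s -> c \in B ->
  {in row_or_col c, A =i B} -> A = B.
Proof.
move=> /submatrixP[A1 [A2 [-> _]]] /submatrixP[B1 [B2 [-> _]]].
case: c => i j; rewrite !inE /= => /andP[iB jB] AB.
have cr i' j' : (i' == i) || (j' == j) -> (i', j') \in row_or_col (i, j).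
  by rewrite inE.
have := AB (i, j) (cr _ _ _); rewrite eqxx !inE /= iB jB => /(_ isT) /andP[iA jA].
have A1B1 i' : (i' \in A1) = (i' \in B1).
  have := AB (i', j) (cr _ _ _); rewrite eqxx orbT !inE /= jA jB !andbT.
  exact.
have A2B2 j' : (j' \in A2) = (j' \in B2).
  have := AB (i, j') (cr _ _ _); rewrite eqxx !inE /= iA iB.
  exact.
by apply/setP => -[i' j']; rewrite !inE /= A1B1 A2B2.
Qed.

Lemma nonzero_found_mem h c : nonzero_found h = Some c -> (c, true) \in h.
Proof.
rewrite /nonzero_found /queried => E.
have : c \in map fst [seq qa <- h | qa.2].
  by move: E; case: map => //= a l [->]; exact: mem_head.
by case/mapP => -[q b]; rewrite mem_filter /= => /andP[-> qh] ->.
Qed.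

Lemma nonzero_found_none h : nonzero_found h = None -> forall qa, qa \in h -> qa.2 = false.
Proof.
rewrite /nonzero_found /queried => E qa qah; apply/negbTE/negP => qa2.
have : qa \in [seq qa <- h | qa.2] by rewrite mem_filter qa2.
by move: E; case: [seq _ <- _ | _].
Qed.

Lemma correct_answer h qa : correct S h -> qa \in h -> qa.2 = (qa.1 \in S).
Proof. by move=> /allP H /H /eqP. Qed.

Lemma candidate_queried h (A : {set coordinate n1 n2}) c : correct S h ->
  A \in candidates s h -> c \in queried h -> (c \in A) = (c \in S).
Proof.
move=> hc; rewrite inE => /andP[_ /allP HA] /mapP[qa qah ->].
by rewrite -(eqP (HA _ qah)) (correct_answer hc qah).
Qed.

Lemma true_support_candidate h : correct S h -> S \in candidates s h.
Proof. by move=> hc; rewrite inE S_sub. Qed.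

Lemma candidates_refined h c : correct S h -> nonzero_found h = Some c ->
  {subset refine c <= queried h} -> candidates s h = [set S]%SET.
Proof.
move=> hc hf sub; apply/setP => A; rewrite finset.in_set1; apply/idP/eqP; last first.
  by move=> ->; exact: true_support_candidate.
move=> Ah; have Asub : A \in submatrices n1 n2 s by move: Ah; rewrite inE => /andP[].
apply: (@submatrix_eq _ _ c) => //.
  by have /= <- := correct_answer hc (nonzero_found_mem hf).
move=> c' c'c; apply: candidate_queried Ah _ => //; apply: sub.
by rewrite (perm_mem (refineP c)) mem_enum.
Qed.

Lemma filter_take_uniq (T : eqType) (L : seq T) k : uniq L ->
  [seq x <- L | x \notin take k L] = drop k L.
Proof.
rewrite -{1}(cat_take_drop k L) cat_uniq => /and3P[_ /hasPn disj _].
transitivity [seq x <- take k L ++ drop k L | x \notin take k L].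
  by rewrite cat_take_drop.
rewrite filter_cat.
rewrite (eq_in_filter (a2 := pred0)) ?filter_pred0; last by move=> x /= ->.
by apply/all_filterP/allP => x /disj.
Qed.

(** Since [order] has no repetition, removing the queried prefix leaves the tail, whose head is the
    next query. This ties a failed search to the first entries of the permutation. *)
Lemma search_prefix j : nonzero_found (state j).1 = None ->
  queried (state j).1 = take (size (state j).1) order.
Proof.
elim: j => [|j ih]; first by rewrite take0.
rewrite run_succ; case: (state j) ih => h z /= ih.
rewrite /run_step; case E : next => [q|] //.
have key b : nonzero_found (rcons h (q, b)) = None ->
    queried (rcons h (q, b)) = take (size (rcons h (q, b))) order.
  rewrite nonzero_found_rcons; case hf : nonzero_found => [//|] _.
  move: E; rewrite /next_query hf; case: ifP => // _; rewrite (ih hf) filter_take_uniq//.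
  move=> qE; rewrite queried_rcons (ih hf) size_rcons.
  have kL : (size h < size order)%N.
    rewrite ltnNge; apply/negP => Lk; by move: qE; rewrite drop_oversize.
  by rewrite (take_nth q kL); move: qE; rewrite (drop_nth q kL) /= => -[->].
by case: ifP => _ /=; [exact: key|case: ifP => _ /=; [exact: key|exact: ih]].
Qed.

(** A run ends in one of four ways: at most one candidate is left, which must be [S]; the search
    budget is spent, excluded by the assumed hit; the row and column are exhausted, which determines
    [S]; or the whole list is exhausted without a positive answer, impossible for a non-empty
    [S]. *)
Lemma estimate_correct j : next (state j).1 = None -> correct S (state j).1 ->
  ~~ all (fun c => c \notin S) (take (Num.truncn (search_budget n1 n2 s delta)) order) ->
  estimate s (state j).1 = S.
Proof.
move=> hN hc hit; set h := (state j).1 in hN hc *.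
suff cS : candidates s h = [set S]%SET by rewrite /estimate cS set1K.
have Sh := true_support_candidate hc.
have small : (#|candidates s h| <= 1)%N -> candidates s h = [set S]%SET.
  by move=> c1; apply/esym/eqP; rewrite eqEcard finset.sub1set Sh cards1.
move: hN; rewrite /next_query; case: ifP => [|nstop].
  rewrite /stopped => /orP[/andP[_ /small]//|/andP[/eqP hf Jh]] _.
  have hsize : (Num.truncn (search_budget n1 n2 s delta) <= size h)%N.
    by rewrite truncn_le_nat.
  case/negP: hit; apply/allP => c cJ.
  have : c \in queried h.
    rewrite (search_prefix hf) -/h; move: cJ.
    by rewrite -(subnKC hsize) takeD mem_cat => ->.
  case/mapP => qa qah ->; rewrite -(correct_answer hc qah).
  by rewrite (nonzero_found_none hf qah).
case hf : nonzero_found => [c|] E.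
  apply: (candidates_refined hc hf) => c' c'c; apply/negPn/negP => c'h.
  have : c' \in [seq q <- refine c | q \notin queried h] by rewrite mem_filter c'h.
  by move: E; case: [seq _ <- _ | _].
have [c cS] : exists c, c \in S.
  by apply/set0Pn; rewrite -card_gt0 (submatrix_card S_sub).
have ch : c \in queried h.
  apply/negPn/negP => ch.
  have : c \in [seq q <- order | q \notin queried h] by rewrite mem_filter ch mem_order.
  by move: E; case: [seq _ <- _ | _].
case/mapP: ch => qa qah cE; move: cS; rewrite cE -(correct_answer hc qah).
by rewrite (nonzero_found_none hf qah).
Qed.

Lemma estimator_stopped k : next (state k).1 = None ->
  estimator s mu delta Gamma refine order S W = estimate s (state k).1.
Proof.
move=> kN; rewrite /estimator; case: pselect => [ex|nex]; last first.
  by exfalso; apply: nex; exists k; apply/eqP.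
case: ex_minnP => j /eqP jN jmin.
by rewrite (run_stopped (jmin k _) jN)//; apply/eqP.
Qed.

Lemma estimator_never : (forall k, next (state k).1 != None) ->
  estimator s mu delta Gamma refine order S W = finset.set0.
Proof.
move=> H; rewrite /estimator; case: pselect => // ex; exfalso.
by case: ex => k; apply/negP; exact: H.
Qed.

(** Even a wrong estimate has at most [s] elements, which is what bounds the symmetric difference on
    the error event. *)
Lemma estimator_submatrix : estimator s mu delta Gamma refine order S W = finset.set0 \/
  estimator s mu delta Gamma refine order S W \in submatrices n1 n2 s.
Proof.
rewrite /estimator; case: pselect => [ex|]; last by left.
rewrite /estimate /unset1; case: ifP => _ /=; last by left.
case: pickP => [A|] /=; last by left.
by rewrite finset.in_set => /andP[Asub _]; right.
Qed.

End estimator_correctness.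

(** * Uniform search *)

Section uniform_search.
Context (R : realType) (T : finType) (S : {set T}).

Definition avoiding k : {set {perm T}} :=
  [set p : {perm T} | all (fun c => c \notin S) (take k [seq p q | q <- enum T])]%SET.

Lemma avoidingP (p : {perm T}) k (x0 : T) : (k <= #|T|)%N ->
  reflect (forall i, (i < k)%N -> p (nth x0 (enum T) i) \notin S) (p \in avoiding k).
Proof.
move=> kT; rewrite inE -map_take all_map.
have sk : size (take k (enum T)) = k by rewrite size_takel// -cardE.
apply: (iffP (all_nthP x0)) => [H i ik|H i]; first by have := H i; rewrite sk nth_take// => /(_ ik).
by rewrite sk => ik; rewrite nth_take//; exact: H.
Qed.

Definition hitting k i (x0 : T) : {set {perm T}} :=
  [set p in avoiding k | p (nth x0 (enum T) i) \in S]%SET.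

Lemma hittingE k i x0 (p : {perm T}) :
  (p \in hitting k i x0) = (p \in avoiding k) && (p (nth x0 (enum T) i) \in S).
Proof. by rewrite [LHS]finset.in_set. Qed.

(* Given that the first [k] draws avoid [S], each of the [#|T| - k] remaining
   positions is equally likely to hold a given element of [S], by exchanging
   positions. *)
Lemma avoiding_exchange k i (x0 : T) : (k <= i < #|T|)%N ->
  #|hitting k i x0| = #|hitting k k x0|.
Proof.
move=> /andP[ki iT]; have kT := leq_ltn_trans ki iT.
pose t := tperm (nth x0 (enum T) i) (nth x0 (enum T) k).
have tI : injective (fun p : {perm T} => (t * p)%g) by exact: mulgI.
have avE p : (t * p)%g \in avoiding k = (p \in avoiding k).
  apply/(avoidingP _ x0 (ltnW kT))/(avoidingP _ x0 (ltnW kT)) => H l lk.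
    have := H l lk; rewrite permM tpermD//.
    - by rewrite nth_uniq ?enum_uniq -?cardE// ?(ltn_trans lk)// gtn_eqF// (leq_trans lk).
    - by rewrite nth_uniq ?enum_uniq -?cardE// ?(ltn_trans lk)// gtn_eqF.
  rewrite permM tpermD//; first exact: H.
  - by rewrite nth_uniq ?enum_uniq -?cardE// ?(ltn_trans lk)// gtn_eqF// (leq_trans lk).
  - by rewrite nth_uniq ?enum_uniq -?cardE// ?(ltn_trans lk)// gtn_eqF.
rewrite -(card_imset _ tI); congr (#|pred_of_set _|); apply/setP => p.
have tt : (t * (t * p))%g = p by rewrite mulgA tperm2 mul1g.
apply/imsetP/idP => [[p' + ->]|].
  by rewrite !hittingE avE permM tpermR.
rewrite hittingE => /andP[pa pS]; exists (t * p)%g; last by rewrite tt.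
by rewrite hittingE avE pa permM tpermL.
Qed.

(** Count pairs of a permutation avoiding [S] up to [k] and a later position mapped into [S]: each
    permutation has [#|S|] such positions, and each position the same number of permutations.
    Replacing [#|T| - k] by [#|T|] compares with drawing with replacement. *)
Lemma card_avoiding_step k : (k < #|T|)%N ->
  (#|avoiding k.+1| * #|T| <= #|avoiding k| * (#|T| - #|S|))%N.
Proof.
move=> kT; have [x0 _] : exists x0 : T, x0 \in T by apply/card_gt0P; exact: leq_ltn_trans kT.
pose B i := hitting k i x0.
have splitk : #|avoiding k| = (#|B k| + #|avoiding k.+1|)%N.
  rewrite -(cardsID (B k) (avoiding k)); congr (_ + _)%N.
    by congr (#|pred_of_set _|); apply/setP => p; rewrite finset.in_setI hittingE andbA andbb.
  congr (#|pred_of_set _|); apply/setP => p; rewrite finset.in_setD hittingE.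
  apply/idP/idP.
    move=> /andP[+ pk]; rewrite pk /= => pS; apply/(avoidingP _ x0 kT) => i.
    rewrite ltnS leq_eqVlt => /orP[/eqP -> //|ik].
    exact: (avoidingP _ x0 (ltnW kT) pk).
  move=> /(avoidingP _ x0 kT) H; apply/andP; split.
    by rewrite negb_and (H k (ltnSn k)) orbT.
  by apply/(avoidingP _ x0 (ltnW kT)) => i ik; apply: H; exact: ltnW.
have count_positions : (#|avoiding k| * #|S| = (#|T| - k) * #|B k|)%N.
  have -> : ((#|T| - k) * #|B k| = \sum_(k <= i < #|T|) #|B i|)%N.
    rewrite -sum_nat_const_nat; apply: eq_big_nat => i ki.
    by rewrite -(@avoiding_exchange k i x0)// .
  under eq_bigr do rewrite -sum1_card big_mkcond.
  rewrite exchange_big /=.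
  rewrite -sum_nat_const big_mkcond; apply: eq_bigr => p _.
  under eq_bigr do rewrite hittingE.
  case: (boolP (p \in avoiding k)) => [pk|_] /=; last by rewrite big1.
  have -> : (\sum_(k <= i < #|T|) (if p (nth x0 (enum T) i) \in S then 1 else 0)
      = \sum_(0 <= i < #|T|) (if p (nth x0 (enum T) i) \in S then 1 else 0))%N.
    rewrite [RHS](big_cat_nat (n := k))//=; last exact: ltnW.
    have -> : (\sum_(0 <= i < k) (if p (nth x0 (enum T) i) \in S then 1 else 0) = 0)%N.
      rewrite big_nat; apply: big1 => i /andP[_ ik].
      by rewrite (negbTE (avoidingP _ x0 (ltnW kT) pk i ik)).
    by rewrite add0n.
  transitivity (\sum_(q <- enum T) (if p q \in S then 1 else 0))%N.
    rewrite big_enum -big_mkcond sum1_card -(card_preimset S (@perm_inj _ p)).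
    by apply: eq_card => q; rewrite [LHS]inE.
  by rewrite (big_nth x0) -cardE.
rewrite mulnBr count_positions.
have nkB : ((#|T| - k) * #|B k| <= #|B k| * #|T|)%N by rewrite mulnC leq_mul2l leq_subr orbT.
by apply: leq_trans (leq_sub2l _ nkB); rewrite splitk mulnDl addKn.
Qed.

Lemma card_avoiding_le k : (0 < #|S|)%N ->
  (#|avoiding k|%:R : R) <= (1 - #|S|%:R / #|T|%:R) ^+ k * #|{perm T}|%:R.
Proof.
move=> S0; have T0 : (0 < #|T|)%N by apply: leq_trans S0 (max_card _).
have ST : (#|S| <= #|T|)%N by exact: max_card.
have TR : 0 < #|T|%:R :> R by rewrite ltr0n.
have q0 : 0 <= 1 - #|S|%:R / #|T|%:R :> R.
  by rewrite subr_ge0 ler_pdivrMr// mul1r ler_nat.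
elim: k => [|k ih]; first by rewrite expr0 mul1r ler_nat max_card.
have [kT|Tk] := ltnP k #|T|.
  rewrite exprS -mulrA; apply: le_trans (ler_wpM2l q0 ih).
  have := card_avoiding_step kT; rewrite -(ler_nat R) !natrM natrB// => step.
  rewrite -(ler_pM2r TR) (le_trans step)// le_eqVlt; apply/orP; left; apply/eqP.
  by field; rewrite gt_eqF.
(* Beyond [#|T|] draws the whole of [T] is listed, including [S]. *)
rewrite (_ : avoiding k.+1 = finset.set0) ?cards0 ?mulr_ge0 ?exprn_ge0//.
apply/setP => p; rewrite [LHS]finset.in_set finset.in_set0; apply/negbTE.
rewrite take_oversize; last by rewrite size_map -cardE leqW.
apply/negP => /allP H; have /card_gt0P[c cS] := S0.
have : c \in [seq p q | q <- enum T].
  by apply/mapP; exists (p^-1%g c); rewrite ?mem_enum// permKV.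
by move/H; rewrite cS.
Qed.

End uniform_search.

(** * Performance of the procedure *)

Section performance.
Context (R : realType) (n1 n2 s : nat) (mu delta Gamma : R).
Context (refine : coordinate n1 n2 -> seq (coordinate n1 n2)).
Context (M : sensing_model R n1 n2) (S : {set coordinate n1 n2}).
Hypothesis refineP : forall c, perm_eq (refine c) (enum (row_or_col c)).
Hypothesis s_gt0 : (0 < s)%N.
Hypothesis delta01 : 0 < delta < 1.
Hypothesis mu_gt0 : 0 < mu.
Hypothesis Gamma_gt0 : 0 < Gamma.
Hypothesis drift_le : Gamma * mu ^+ 2 / 2 <= 12^-1.
Hypothesis S_sub : S \in submatrices n1 n2 s.

Local Notation P := (sm_prob M S).
Local Notation drift := (Gamma * mu ^+ 2 / 2).
Local Notation next := (next_query s delta refine).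
Local Notation estim := (Shat s mu delta Gamma refine (M := M) S).
Local Notation st := (state_at s mu delta Gamma refine (M := M) S).
Local Notation n := ((n1 * n2)%:R : R).

Let S_card : #|S| = s. Proof. exact: submatrix_card S_sub. Qed.

Let card_coordinate : #|{: coordinate n1 n2}| = (n1 * n2)%N.
Proof. by rewrite card_prod !card_ord. Qed.

Let s_le : (s <= n1 * n2)%N.
Proof. by rewrite -S_card -card_coordinate max_card. Qed.

Let n_gt0 : (0 < n1 * n2)%N. Proof. exact: leq_trans s_gt0 s_le. Qed.

Lemma search_order_uniq w : uniq (search_order (M := M) w).
Proof. by rewrite map_inj_uniq ?enum_uniq//; exact: perm_inj. Qed.

Lemma mem_search_order w c : c \in search_order (M := M) w.
Proof.
by apply/mapP; exists ((sm_perm w)^-1%g c); rewrite ?mem_enum// permKV.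
Qed.

Lemma measurable_estimator_event (A : {set coordinate n1 n2}) :
  measurable [set w | estim w = A].
Proof.
pose ev (B : {set coordinate n1 n2}) k := [set w |
  (next (search_order w) (st w k).1 == None) && (estimate s (st w k).1 == B)].
have mev B : measurable (\bigcup_k ev B k).
  apply: bigcupT_measurable => k.
  exact: (measurable_history_event s mu delta refine M S Gamma_gt0
    (fun order h => (next order h == None) && (estimate s h == B))).
have nonempty B : B != finset.set0 -> [set w | estim w = B] = \bigcup_k ev B k.
  move=> B0; apply/seteqP; split => [w /= wB|w [k _ /= /andP[/eqP kN /eqP <-]]].
    have [[k kN]|nk] := pselect (exists k, next (search_order w) (st w k).1 == None).
      exists k => //; apply/andP; split => //; rewrite -wB.
      by apply/eqP/esym; apply: estimator_stopped; exact/eqP.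
    exfalso; move/eqP: B0; apply; rewrite -wB; apply: estimator_never => k.
    by apply/negP => kN; apply: nk; exists k.
  exact: estimator_stopped.
(* The empty set is also the value of runs that never end, so its event is the complement of the
   finitely many others. *)
have [->|A0] := eqVneq A finset.set0; last by rewrite nonempty.
rewrite (_ : [set w | estim w = finset.set0] = ~` \bigcup_(B in [set B | B != finset.set0])
    [set w | estim w = B]).
  apply: measurableC; apply: fin_bigcup_measurable; first exact: finite_finset.
  by move=> B B0; rewrite nonempty.
apply/seteqP; split => [w /= wE [B /= B0 wB]|w /= nw].
  by move: B0; rewrite -wB wE eqxx.
have [//|w0] := eqVneq (estim w) finset.set0.
by exfalso; apply: nw; exists (estim w).
Qed.

Lemma measurable_estimator_fun (g : {set coordinate n1 n2} -> R) :
  measurable_fun setT (fun w => g (estim w)).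
Proof.
move=> _ B mB; rewrite setTI.
rewrite (_ : _ @^-1` B = \bigcup_(A in [set A | B (g A)]) [set w | estim w = A]).
  apply: fin_bigcup_measurable; first exact: finite_finset.
  by move=> A _; exact: measurable_estimator_event.
apply/seteqP; split => [w /= wB|w [A /= BA wA]]; first by exists (estim w).
by rewrite /preimage /= wA.
Qed.

(** The three terms contribute at most [delta / 4], [delta / 4] and [delta / 2]. *)
Lemma error_left_nil_le : error_left s delta S [::] <= delta.
Proof.
rewrite /error_left !unqueried_nil -!cardE S_card /=.
have /andP[d0 _] := delta01.
have sR : 0 < s%:R :> R by rewrite ltr0n.
have nR : 0 < n by rewrite ltr0n.
have CR : #|(~: S)%SET|%:R <= n by rewrite ler_nat -card_coordinate max_card.
have e1 : s%:R * (delta / (4 * s%:R)) = delta / 4 by field; rewrite gt_eqF.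
have e2 : #|(~: S)%SET|%:R * (delta / (4 * n)) <= delta / 4.
  apply: (@le_trans _ _ (n * (delta / (4 * n)))).
    by apply: ler_wpM2r => //; rewrite divr_ge0 ?mulr_ge0// ltW.
  rewrite le_eqVlt; apply/orP; left; apply/eqP.
  by move: nR; move: n => N N0; field; rewrite gt_eqF.
lra.
Qed.

(** With [r = s / n], rounding the budget down to [K] loses at most one query, so
    [(1 - r)^K <= exp (1 - ln (2 / delta))]. This is [e * delta / 2], and the crude [e <= 4]
    suffices. *)
Lemma missed_probability_le :
  (P [set w | ((@sm_perm _ _ _ M) w) \in avoiding S (Num.truncn (search_budget n1 n2 s delta))]
    <= (2 * delta)%:E)%E.
Proof.
have /andP[d0 d1] := delta01.
set K := Num.truncn _; set A := [set w | _].
have := @sm_perm_set_law _ _ _ M S [set p | p \in avoiding S K] 0 (fun=> setT)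
  (fun=> measurableT).
rewrite big_ord0 mulr1 (_ : \bigcap_(j in `I_0) _ = setT); last by apply/seteqP; split.
rewrite setIT => E; have -> : P A = (#|avoiding S K|%:R / #|{perm coordinate n1 n2}|%:R)%:E.
  rewrite -[LHS]/(P ((@sm_perm _ _ _ M) @^-1` [set p | p \in avoiding S K])) E.
  congr (_%:R / _)%:E; apply: eq_card => p.
  by apply/idP/idP => [/set_mem //|pA]; exact: (mem_set pA).
have sR : 0 < s%:R :> R by rewrite ltr0n.
have nR : 0 < n by rewrite ltr0n.
have pR : 0 < #|{perm coordinate n1 n2}|%:R :> R.
  by rewrite ltr0n; apply/card_gt0P; exists 1%g.
rewrite lee_fin ler_pdivrMr//.
have cS : (0 < #|S|)%N by rewrite S_card.
apply: le_trans (card_avoiding_le R K cS) _.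
rewrite ler_pM2r// S_card card_coordinate.
set r := s%:R / n.
have r0 : 0 < r by rewrite divr_gt0.
have r1 : r <= 1 by rewrite ler_pdivrMr// mul1r ler_nat.
have KJ : search_budget n1 n2 s delta <= K%:R + 1.
  by rewrite natr1 ltW// -truncn_le_nat.
have rJ : r * search_budget n1 n2 s delta = ln (2 / delta).
  by rewrite /r /search_budget; move: nR; move: n => N N0; field; rewrite !gt_eqF.
have e4 : expR 1 <= 4 :> R.
  have h : 2^-1 <= expR (- 2^-1) :> R by have := expR_ge1Dx (- 2^-1 : R); lra.
  have := expRxMexpNx_1 (2^-1 : R); have := expR_gt0 (2^-1 : R).
  have -> : expR 1 = expR 2^-1 * expR 2^-1 :> R by rewrite -expRD; congr expR; field.
  by move: h; move: (expR _) (expR _) => a b; nra.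
have rexp : 1 - r <= expR (- r) by exact: expR_ge1Dx.
apply: (@le_trans _ _ (expR (- r) ^+ K)).
  by apply: lerXn2r; rewrite ?nnegrE ?expR_ge0// subr_ge0.
rewrite -expRM_natr; apply: (@le_trans _ _ (expR (1 - ln (2 / delta)))).
  by rewrite ler_expR; nra.
have p2 : 0 < 2 / delta by rewrite divr_gt0.
rewrite expRD expRN lnK ?posrE// invf_div.
by nra.
Qed.

Lemma estimator_correct w k :
  next (search_order w) (st w k).1 = None -> correct S (st w k).1 ->
  (@sm_perm _ _ _ M) w \notin avoiding S (Num.truncn (search_budget n1 n2 s delta)) ->
  estim w = S.
Proof.
move=> kN kc kA; rewrite /Shat (estimator_stopped kN).
apply: (estimate_correct refineP s_gt0 (search_order_uniq w) (mem_search_order w)) => //.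
by move: kA; rewrite finset.in_set.
Qed.

Lemma error_probability_le :
  (error_probability s mu delta Gamma refine M S <= (4 * delta)%:E)%E.
Proof.
have /andP[d0 d1] := delta01.
have dr0 : 0 < drift by rewrite divr_gt0// mulr_gt0// exprn_gt0.
set B := precision_left s delta refine S [::].
(* A horizon by which the run has stopped except with probability [delta]. *)
have [k k0 kB] : exists2 k : nat, (0 < k)%N & B <= k%:R * drift * delta.
  exists (Num.truncn (B / (drift * delta))).+1 => //.
  rewrite -mulrA -ler_pdivrMr ?mulr_gt0// ltW//.
  by rewrite -truncn_le_nat.
pose E1 := [set w | ~~ correct S (st w k).1].
pose E2 := [set w | (@sm_perm _ _ _ M) w \in avoiding S (Num.truncn (search_budget n1 n2 s delta))].
pose E3 := [set w | next (search_order w) (st w k).1 != None].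
have mE1 : measurable E1.
  exact: (measurable_history_event s mu delta refine M S Gamma_gt0
    (fun _ h => ~~ correct S h)).
have mE2 : measurable E2.
  exact: (@measurable_sm_perm_preimage _ _ _ M [set p | p \in avoiding S _]).
have mE3 : measurable E3.
  exact: (measurable_history_event s mu delta refine M S Gamma_gt0
    (fun order h => next order h != None)).
have mE12 : measurable (E1 `|` E2) by exact: measurableU.
have PE1 : (P E1 <= delta%:E)%E.
  apply: le_trans (incorrect_probability_le mu refine M S n_gt0 s_gt0 delta01 Gamma_gt0 k) _.
  by rewrite lee_fin error_left_nil_le.
have PE2 : (P E2 <= (2 * delta)%:E)%E by exact: missed_probability_le.
have PE3 : (P E3 <= delta%:E)%E.
  have := unstopped_probability_le M S refineP n_gt0 s_gt0 delta01 Gamma_gt0 k drift_le.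
  rewrite -/E3 -/B; have : (P E3 <= 1)%E by exact: probability_le1.
  have : (0 <= P E3)%E by exact: measure_ge0.
  case: (P E3) => [x| |] //; rewrite -EFinM !lee_fin => x0 x1 kx.
  have kd0 : 0 < k%:R * drift by rewrite mulr_gt0// ltr0n.
  by rewrite -(ler_pM2l kd0) (le_trans kx).
rewrite /error_probability.
have mErr : measurable [set w | estim w <> S].
  by have := measurableC (measurable_estimator_event S).
apply: (@le_trans _ _ (P ((E1 `|` E2) `|` E3))).
  apply: le_measure; rewrite ?inE//; first exact: measurableU.
  move=> w /= wS; have [c1|] := boolP (correct S (st w k).1); last by left; left.
  have [|c2] := boolP ((@sm_perm _ _ _ M) w \in
      avoiding S (Num.truncn (search_budget n1 n2 s delta))).
    by left; right.
  right => /=; apply/negP => /eqP kN; apply: wS; exact: (estimator_correct kN).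
apply: le_trans (measureU2 _ mE12 mE3) _.
apply: le_trans (leeD (measureU2 _ mE1 mE2) (lexx _)) _.
apply: le_trans (leeD (leeD PE1 PE2) PE3) _.
by rewrite -!EFinD lee_fin; lra.
Qed.

Lemma expected_symdiff_le :
  (expected_symdiff s mu delta Gamma refine M S <= (8 * s%:R * delta)%:E)%E.
Proof.
set E := [set w | estim w <> S].
have mE : measurable E by exact: (measurableC (measurable_estimator_event S)).
rewrite /expected_symdiff unlock.
apply: (@le_trans _ _ (\int[P]_w ((2 * s%:R)%:E * (\1_E w)%:E))%E).
  apply: ge0_le_integral => //.
  - move/measurable_EFinP: (measurable_estimator_fun
      (fun A => #|(A :\: S) :|: (S :\: A)|%SET%:R)).
    exact.
  - by apply: emeasurable_funM => //; exact/measurable_EFinP/measurable_indic.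
  - move=> w _; rewrite -EFinM lee_fin indicE.
    have [->|wS] := eqVneq (estim w) S; first by rewrite finset.setDv finset.setU0 cards0 mulr_ge0.
    rewrite mem_set ?mulr1; last exact/eqP.
    have cw : (#|estim w| <= s)%N.
      rewrite /Shat; have [->|/submatrix_card ->//] := @estimator_submatrix R n1 n2 s mu delta Gamma
        refine (search_order w) S (fun j => sm_noise M j w).
      by rewrite cards0.
    rewrite -natrM ler_nat mul2n -addnn.
    apply: leq_trans (leq_of_leqif (leq_card_setU _ _)) _.
    rewrite leq_add//.
      by apply: leq_trans cw; apply: subset_leq_card; exact: finset.subsetDl.
    by rewrite -S_card; apply: subset_leq_card; exact: finset.subsetDl.
rewrite ge0_integralZl_EFin//; last exact/measurable_EFinP/measurable_indic.
rewrite integral_indic// setIT.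
have := error_probability_le; rewrite /error_probability -/E => PE.
apply: (@le_trans _ _ ((2 * s%:R)%:E * (4 * delta)%:E)%E).
  by apply: lee_wpmul2l => //; rewrite lee_fin mulr_ge0.
by rewrite -EFinM lee_fin; lra.
Qed.

End performance.

(** * Asymptotics *)

Section asymptotics.
Context (R : realType).

Lemma cvge0_of_bound (f : nat -> \bar R) : (forall N, 0 <= f N)%E ->
  (forall e, 0 < e -> \forall N \near \oo, (f N <= e%:E)%E) -> f N @[N --> \oo] --> 0%E.
Proof.
move=> f0 fe; apply: cvg_EFin.
  near=> N; rewrite ge0_fin_numE//.
  have : (f N <= 1%:E)%E by near: N; exact: fe.
  by move/le_lt_trans; apply; rewrite ltry.
apply/cvgr0Pnorm_le => e e0; near=> N.
have : (f N <= e%:E)%E by near: N; exact: fe.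
have := f0 N; rewrite /=; case: (f N) => [x| |] //=; rewrite !lee_fin => x0 xe.
by rewrite ger0_norm.
Unshelve. all: by end_near. Qed.

(** The constant [1/8] in the little-o is small enough for the lower-order costs to fit into the
    shift [10] later; the middle bound follows from the last since [ln (N ^ 2) >= 1] for
    [N >= 2]. *)
Lemma sparse_eventually (s : nat -> nat) :
  (fun N : nat => (s N)%:R : R) =o_\oo
    (fun N : nat => Num.sqrt (N ^ 2)%N%:R / ln (N ^ 2)%N%:R : R) ->
  \forall N \near \oo, [/\ (0 < N)%N, 8 * (s N)%:R <= N%:R :> R &
    8 * (s N)%:R * ln (N ^ 2)%N%:R <= N%:R :> R].
Proof.
move/eqoP => /(_ 8^-1 ltac:(rewrite invr_gt0; lra)) small.
near=> N.
have N2 : (2 <= N)%N by near: N; exists 2%N.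
have NR : 2 <= N%:R :> R by rewrite ler_nat.
have := near small N => /(_ ltac:(by [])).
rewrite natrX sqrtr_sqr (ger0_norm (ler0n R (s N))) (ger0_norm (ler0n R N)).
have ln1 : 1 <= ln (N%:R ^+ 2) :> R.
  have N0 : 0 < N%:R :> R by lra.
  have := @le_ln1Dx R (N%:R^-1 - 1); rewrite addrCA subrr addr0 lnV ?posrE//.
  have V0 : 0 < N%:R^-1 :> R by rewrite invr_gt0.
  have V2 : N%:R^-1 <= 2^-1 :> R by rewrite lef_pV2 ?posrE//; lra.
  move=> /(_ ltac:(lra)) h; rewrite lnXn// mulr2n; lra.
rewrite ger0_norm; last by rewrite divr_ge0//; lra.
move: ln1; set L := ln _ => ln1 sN.
have LE : N%:R / L * L = N%:R by rewrite divfK// gt_eqF//; lra.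
have q0 : 0 <= N%:R / L :> R by rewrite divr_ge0//; lra.
have s0 : 0 <= (s N)%:R :> R by [].
split; [exact: leq_trans N2|nra|nra].
Unshelve. all: by end_near. Qed.

Let ln2_le1 : ln 2 <= 1 :> R.
Proof. by have := @le_ln1Dx R 1; apply; lra. Qed.

(** With [Q = n / s], sparsity gives [64 * s <= Q] and [8 * N <= Q], also after multiplying the left
    sides by [8 * L], up to the corresponding constants. Only the search term is quadratic in
    [l = - ln delta], with coefficient [Q]. *)
Lemma precision_left_nil_le (N s : nat) (delta : R)
    (refine : coordinate N N -> seq (coordinate N N)) (S : {set coordinate N N}) :
  (0 < N)%N -> (1 <= s)%N -> 8 * s%:R <= N%:R :> R -> 8 * s%:R * ln (N ^ 2)%N%:R <= N%:R :> R ->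
  0 < delta < 1 -> #|S| = s ->
  precision_left s delta refine S [::] <= (N ^ 2)%N%:R / s%:R * (10 - ln delta) ^+ 2.
Proof.
move=> N0 s1 sN sL /andP[d0 d1] cS.
have NR : 1 <= N%:R :> R by rewrite ler1n.
have sR : 1 <= s%:R :> R by rewrite ler1n.
have d0' : delta \is Num.pos by rewrite posrE.
have l0 : 0 <= - ln delta by rewrite oppr_ge0 ln_le0// ltW.
have pos_nat (k : nat) : k.+1%:R \is @Num.pos R by rewrite posrE.
have sP : (s%:R : R) \is Num.pos by rewrite posrE; lra.
have nP : ((N ^ 2)%N%:R : R) \is Num.pos by rewrite posrE ltr0n expn_gt0 N0.
have ln4 : ln 4 <= 2 :> R.
  have -> : 4 = 2 ^+ 2 :> R by ring.
  by rewrite lnXn// mulr2n; have := ln2_le1; lra.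
have ln8 : ln 8 <= 3 :> R.
  have -> : 8 = 2 ^+ 3 :> R by ring.
  by rewrite lnXn// -[leLHS]mulr_natr; have := ln2_le1; lra.
rewrite /precision_left unqueried_nil -cardE cS /= subr0.
rewrite /nonzero_test_cost /search_test_cost /refine_test_cost /search_budget mulnn.
rewrite !ln_div ?posrE ?mulr_gt0// ?lnM ?posrE// -?posrE//.
move: sL; set L := ln (N ^ 2)%N%:R => sL.
have lnsL : ln s%:R <= L.
  rewrite ler_ln// ler_nat -(ler_nat R) natrX.
  nra.
have L0 : 0 <= L by apply: ln_ge0; rewrite ler1n expn_gt0 N0.
have lns0 : 0 <= ln s%:R :> R by exact: ln_ge0.
have -> : (N + N)%N%:R = 2 * N%:R :> R by rewrite natrD; ring.
rewrite natrX; have := ln2_le1.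
move: l0; set l := - ln delta => l0 ln2.
have ln20 : 0 <= ln 2 :> R by apply: ln_ge0; lra.
have ln40 : 0 <= ln 4 :> R by apply: ln_ge0; lra.
set Q := N%:R ^+ 2 / s%:R.
have QE : Q * s%:R = N%:R ^+ 2 by rewrite divfK// gt_eqF//; lra.
have s0 : 0 < s%:R :> R by lra.
have QN : 8 * N%:R <= Q by rewrite -(ler_pM2r s0) QE; nra.
have QL : 8 * (N%:R * L) <= Q by rewrite -(ler_pM2r s0) QE; nra.
have Q0 : 0 <= Q by lra.
have -> : Num.max 0 (Q * (ln 2 + l)) = Q * (ln 2 + l).
  by apply: max_idPr; rewrite mulr_ge0//; lra.
have t1 : s%:R * (ln 8 + L + l + 6) <= Q / 64 * (10 + l).
  have : s%:R * (ln 8 + L + l + 6) <= s%:R * (9 + l) + s%:R * L by nra.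
  by nra.
have t2 : Q * (ln 2 + l) * (ln 4 + l + 6) <= Q * (9 + l) ^+ 2.
  rewrite -mulrA ler_wpM2l// expr2; apply: ler_pM; lra.
have t3 : 2 * N%:R * (ln 8 + ln s%:R + l + 6) <= Q / 4 * (10 + l).
  have : 2 * N%:R * (ln 8 + ln s%:R + l + 6) <= 2 * (N%:R * (9 + l)) + 2 * (N%:R * L) by nra.
  by nra.
(* Passing from [9] to [10] frees [Q * (19 + 2 * l)], more than the [Q * (1/64 + 1/4) * (10 + l)] of
   the other two terms. *)
have -> : (10 + l) ^+ 2 = (9 + l) ^+ 2 + (19 + 2 * l) by ring.
nra.
Qed.

Lemma expected_precision_budget (N s : nat) (m mu delta Gamma : R)
    (refine : coordinate N N -> seq (coordinate N N)) (M : sensing_model R N N)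
    (S : {set coordinate N N}) :
  (forall c, perm_eq (refine c) (enum (row_or_col c))) ->
  (0 < N)%N -> (1 <= s)%N -> 8 * s%:R <= N%:R :> R -> 8 * s%:R * ln (N ^ 2)%N%:R <= N%:R :> R ->
  0 < delta < 1 -> 0 < mu -> 0 < Gamma -> Gamma * mu ^+ 2 / 2 <= 12^-1 ->
  S \in submatrices N N s ->
  2 * ((N ^ 2)%N%:R / s%:R * (10 - ln delta) ^+ 2) <= mu ^+ 2 * m ->
  (expected_precision s mu delta Gamma refine M S <= m%:E)%E.
Proof.
move=> refineP N0 s1 sN sL d01 mu0 G0 drift_le SN mum.
have NN0 : (0 < N * N)%N by rewrite muln_gt0 N0.
apply: le_trans (expected_precision_le M S refineP NN0 s1 d01 mu0 G0 drift_le) _.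
rewrite lee_fin mulrAC ler_pdivrMr ?exprn_gt0// [leRHS]mulrC; apply: le_trans mum.
rewrite ler_pM2l//; apply: precision_left_nil_le => //.
exact: submatrix_card SN.
Qed.

(** [delta] must lie in [(0, 1)] for every index, but the intended values do so only eventually;
    [1/2] is a placeholder. *)
Definition capped (x : R) : R := if 0 < x < 1 then x else 2^-1.

Lemma capped_bounds x : 0 < capped x < 1.
Proof. by rewrite /capped; case: ifPn => // _; apply/andP; split; lra. Qed.

Lemma expR_sub_small (u : nat -> R) (c a eta : R) : u N @[N --> \oo] --> +oo -> 0 < a ->
  0 < eta -> \forall N \near \oo, expR (c - a * u N) <= eta.
Proof.
move=> uoo a0 eta0; near=> N; rewrite -[eta]lnK ?posrE// ler_expR.
suff : (c - ln eta) / a < u N by rewrite ltr_pdivrMr//; lra.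
by near: N; exact: cvgry_gt.
Unshelve. all: by end_near. Qed.

End asymptotics.

Theorem corollary6 (R : realType) (s : nat -> nat) (m mu omega : nat -> R)
  (refine : forall N : nat, coordinate N N -> seq (coordinate N N))
  (refineP : forall (N : nat) (c : coordinate N N),
     perm_eq (refine N c) (enum (row_or_col c)))
  (s_ge1 : forall N : nat, (0 < N)%N -> (1 <= s N)%N)
  (s_littleo : (fun N : nat => (s N)%:R : R) =o_\oo
     (fun N : nat => Num.sqrt (N ^ 2)%N%:R / ln (N ^ 2)%N%:R : R))
  (class_nonempty : forall N : nat, (0 < N)%N ->
     submatrices N N (s N) <> finset.set0)
  (m_gt0 : forall N : nat, (0 < N)%N -> 0 < m N)
  (mu_gt0 : forall N : nat, (0 < N)%N -> 0 < mu N)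
  (omega_infty : omega N @[N --> \oo] --> +oo) :
  ((forall N : nat, (0 < N)%N ->
      omega N * Num.sqrt ((N ^ 2)%N%:R / ((s N)%:R * m N)) <= mu N) ->
   exists delta : nat -> R, (forall N : nat, 0 < delta N < 1) /\
   exists Gamma0 : nat -> R, (forall N : nat, 0 < Gamma0 N) /\
   forall Gamma : nat -> R, (forall N : nat, 0 < Gamma N <= Gamma0 N) ->
   forall M : (forall N : nat, sensing_model R N N),
     \big[maxe/0%E]_(S in submatrices N N (s N))
        error_probability (s N) (mu N) (delta N) (Gamma N) (@refine N) (M N) S
       @[N --> \oo] --> 0%E
     /\
     \forall N \near \oo, forall S : {set coordinate N N},
       S \in submatrices N N (s N) ->
       (expected_precision (s N) (mu N) (delta N) (Gamma N) (@refine N) (M N) S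
          <= (m N)%:E)%E)
  /\
  ((forall N : nat, (0 < N)%N ->
      Num.sqrt (2 * (N ^ 2)%N%:R / ((s N)%:R * m N)
                  * (ln (s N)%:R + omega N) ^+ 2) <= mu N) ->
   exists delta : nat -> R, (forall N : nat, 0 < delta N < 1) /\
   exists Gamma0 : nat -> R, (forall N : nat, 0 < Gamma0 N) /\
   forall Gamma : nat -> R, (forall N : nat, 0 < Gamma N <= Gamma0 N) ->
   forall M : (forall N : nat, sensing_model R N N),
     \big[maxe/0%E]_(S in submatrices N N (s N))
        expected_symdiff (s N) (mu N) (delta N) (Gamma N) (@refine N) (M N) S
       @[N --> \oo] --> 0%E
     /\
     \forall N \near \oo, forall S : {set coordinate N N},
       S \in submatrices N N (s N) ->
       (expected_precision (s N) (mu N) (delta N) (Gamma N) (@refine N) (M N) S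
          <= (m N)%:E)%E).
Proof.
(* The precision budget closes as soon as [2 n / s * (10 - ln delta)^2] is at most
   [mu^2 m]; [delta] is chosen to make [10 - ln delta] equal to [omega / 2], resp.
   [ln s + omega]. *)
have sparse := sparse_eventually s_littleo.
(* Chosen so that the drift is at most [1/12]; the [+ 1] keeps it positive even at [N = 0], where
   [mu] is unconstrained. *)
pose Gamma0 N : R := (6 * (mu N ^+ 2 + 1))^-1.
have Gamma0_gt0 N : 0 < Gamma0 N by rewrite invr_gt0; have := sqr_ge0 (mu N); nra.
have drift_le (Gamma : nat -> R) N : 0 < Gamma N <= Gamma0 N -> Gamma N * mu N ^+ 2 / 2 <= 12^-1.
  have mu2 := sqr_ge0 (mu N); have p : 0 < 6 * (mu N ^+ 2 + 1) by lra.
  by move=> /andP[G0]; rewrite /Gamma0 -[_^-1]mul1r ler_pdivlMr//; nra.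
have Gamma_gt0 (Gamma : nat -> R) N : 0 < Gamma N <= Gamma0 N -> 0 < Gamma N by case/andP.
split => mu_ge.
- pose x N : R := expR (10 - 2^-1 * omega N).
  exists (fun N => capped (x N)); split; first by move=> N; exact: capped_bounds.
  exists Gamma0; split => // Gamma GammaP M.
  have xE : \forall N \near \oo, capped (x N) = x N.
    near=> N; rewrite /capped expR_gt0 /=; case: ifPn => //; rewrite -leNgt => x1.
    have : x N <= 2^-1.
      by near: N; apply: expR_sub_small => //; rewrite invr_gt0.
    by lra.
  split.
    apply: cvge0_of_bound => [N|e e0]; first exact: bigmax_ge_id.
    near=> N.
    have N0 : (0 < N)%N by near: N; exists 1%N.
    apply: bigmax_le => [|S SN]; first by rewrite lee_fin ltW.
    apply: (@le_trans _ _ (4 * capped (x N))%:E).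
      by apply: error_probability_le => //; solve [exact: refineP|exact: s_ge1|
      exact: capped_bounds|exact: mu_gt0|exact: Gamma_gt0|exact: drift_le].
    have xN : capped (x N) = x N by near: N.
    rewrite lee_fin xN.
    have : x N <= e / 4.
      by near: N; apply: expR_sub_small => //; rewrite ?invr_gt0// divr_gt0.
    by lra.
  near=> N; move=> S SN.
  have := near sparse N => /(_ ltac:(by [])) [N0 sN sL].
  have sR : 0 < (s N)%:R :> R by rewrite ltr0n s_ge1.
  have nR : 0 < (N ^ 2)%N%:R :> R by rewrite ltr0n expn_gt0 N0.
  (* The lower bound on [mu] is about to be squared, so its sign matters. *)
  have om0 : 0 < omega N by near: N; exact: cvgry_gt.
  suff budget : 2 * ((N ^ 2)%N%:R / (s N)%:R * (10 - ln (capped (x N))) ^+ 2) <= mu N ^+ 2 * m N.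
    by apply: expected_precision_budget => //; solve [exact: refineP|exact: s_ge1|
      exact: capped_bounds|exact: mu_gt0|exact: Gamma_gt0|exact: drift_le].
  have xN : capped (x N) = x N by near: N.
  rewrite xN expRK.
  have sq : (omega N * Num.sqrt ((N ^ 2)%N%:R / ((s N)%:R * m N))) ^+ 2 <= mu N ^+ 2.
    have muN := mu_ge N N0.
    by apply: lerXn2r => //; rewrite nnegrE ?mulr_ge0 ?sqrtr_ge0// ltW// mu_gt0.
  have q0 : 0 <= (N ^ 2)%N%:R / ((s N)%:R * m N) by rewrite divr_ge0// mulr_ge0// ltW// m_gt0.
  rewrite exprMn sqr_sqrtr// in sq.
  have mN := m_gt0 N N0.
  have : omega N ^+ 2 * ((N ^ 2)%N%:R / (s N)%:R) <= mu N ^+ 2 * m N.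
    apply: le_trans (ler_wpM2r (ltW mN) sq); rewrite le_eqVlt; apply/orP; left; apply/eqP.
    by field; rewrite !gt_eqF.
  have nn0 : 0 <= (N ^ 2)%N%:R / (s N)%:R :> R by rewrite divr_ge0.
  (* Halving [omega] pays for the factor 2 of the budget: [2 * (omega / 2)^2 <= omega^2]. *)
  rewrite (_ : 10 - (10 - 2^-1 * omega N) = omega N / 2); last by field.
  rewrite expr_div_n; have := sqr_ge0 (omega N); nra.
(* Dividing by [s] offsets the factor [s] in the bound [8 * s * delta] on the symmetric
   difference. *)
- pose x N : R := expR (10 - 1 * omega N) / (s N)%:R.
  exists (fun N => capped (x N)); split; first by move=> N; exact: capped_bounds.
  exists Gamma0; split => // Gamma GammaP M.
  have s_gt0 : \forall N \near \oo, 0 < (s N)%:R :> R.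
    near=> N; have N0 : (0 < N)%N by near: N; exists 1%N.
    by rewrite ltr0n s_ge1.
  have xs : \forall N \near \oo, (s N)%:R * x N = expR (10 - 1 * omega N).
    by near=> N; rewrite /x mulrC divfK// gt_eqF//; near: N.
  have xE : \forall N \near \oo, capped (x N) = x N.
    near=> N.
    have sN : 0 < (s N)%:R :> R by near: N.
    have s1 : 1 <= (s N)%:R :> R by rewrite ler1n -(ltr0n R).
    have x0 : 0 < x N by rewrite divr_gt0 ?expR_gt0.
    rewrite /capped x0 /=; case: ifPn => //; rewrite -leNgt => x1.
    have : (s N)%:R * x N <= 2^-1.
      have -> : (s N)%:R * x N = expR (10 - 1 * omega N) by near: N.
      by near: N; apply: expR_sub_small => //; rewrite invr_gt0.
    by nra.
  split.
    apply: cvge0_of_bound => [N|e e0]; first exact: bigmax_ge_id.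
    near=> N.
    have N0 : (0 < N)%N by near: N; exists 1%N.
    apply: bigmax_le => [|S SN]; first by rewrite lee_fin ltW.
    apply: (@le_trans _ _ (8 * (s N)%:R * capped (x N))%:E).
      by apply: expected_symdiff_le => //; solve [exact: refineP|exact: s_ge1|
      exact: capped_bounds|exact: mu_gt0|exact: Gamma_gt0|exact: drift_le].
    have xN : capped (x N) = x N by near: N.
    have xsN : (s N)%:R * x N = expR (10 - 1 * omega N) by near: N.
    rewrite lee_fin xN -mulrA xsN.
    have : expR (10 - 1 * omega N) <= e / 8.
      by near: N; apply: expR_sub_small => //; rewrite divr_gt0.
    by lra.
  near=> N; move=> S SN.
  have := near sparse N => /(_ ltac:(by [])) [N0 sN sL].
  have sR : 0 < (s N)%:R :> R by rewrite ltr0n s_ge1.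
  have nR : 0 < (N ^ 2)%N%:R :> R by rewrite ltr0n expn_gt0 N0.
  suff budget : 2 * ((N ^ 2)%N%:R / (s N)%:R * (10 - ln (capped (x N))) ^+ 2) <= mu N ^+ 2 * m N.
    by apply: expected_precision_budget => //; solve [exact: refineP|exact: s_ge1|
      exact: capped_bounds|exact: mu_gt0|exact: Gamma_gt0|exact: drift_le].
  have xN : capped (x N) = x N by near: N.
  rewrite xN ln_div ?posrE ?expR_gt0// expRK.
  have mN := m_gt0 N N0; have := mu_ge N N0.
  set B := 2 * _ / _ * _ => muN.
  have B0 : 0 <= B by rewrite mulr_ge0 ?sqr_ge0// divr_ge0 ?mulr_ge0// ltW.
  have sq : Num.sqrt B ^+ 2 <= mu N ^+ 2.
    by apply: lerXn2r => //; rewrite nnegrE ?sqrtr_ge0// ltW// mu_gt0.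
  rewrite sqr_sqrtr// in sq.
  (* Here the required amount equals [B * m]: the constants match exactly. *)
  apply: le_trans (ler_wpM2r (ltW mN) sq); rewrite le_eqVlt; apply/orP; left; apply/eqP.
  by rewrite /B; field; rewrite !gt_eqF.
Unshelve. all: by end_near. Qed.
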